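(* Let $\mathcal{H}$ be a separable Hilbert space, $\mathcal{L}_0\subset\mathcal{H}$ a closed subspace with orthogonal projection $P_0$, and let $\delta(t)=e^{itZ}\mathcal{L}_0$ be a geodesic of the Grassmann manifold of $\mathcal{H}$ starting at $\delta(0)=\mathcal{L}_0$, where $Z=Z^*$ is co-diagonal with respect to $\mathcal{H}=\mathcal{L}_0\oplus\mathcal{L}_0^\perp$ and $\|Z\|\le\pi/2$. Then the following are equivalent: (1) $e^{it_0Z}\in\mathbf{Sd}_{\mathcal{L}_0}$ for some real $t_0\neq0$. (2) $e^{itZ}\in\mathbf{Sd}_{\mathcal{L}_0}$ for all $t\in\mathbb{R}$. (3) $Z'$, the generic part of $Z$, is diagonalizable. In this case, $e^{itZ}$ and the commutators $[P_0,P_{\delta(t)}]$ are simultaneously diagonalizable, for $t\in\mathbb{R}$.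
   Context: $P_{\mathcal{S}}$ denotes the orthogonal projection onto a closed subspace $\mathcal{S}$. An operator is diagonalizable if there is an orthonormal basis of the space consisting of its eigenvectors; simultaneously diagonalizable means with a common such basis. A bounded operator $T$ is Schmidt decomposable if there exist (finite or countable) orthonormal systems $\{f_n\}_{n\ge1}$, $\{g_n\}_{n\ge1}$ and positive numbers $s_n$ such that $T=\sum_{n\ge1}s_n\,f_n\otimes g_n$ (strong convergence), where $(f\otimes g)(h)=\langle h,g\rangle f$. $\mathbf{Sd}_{\mathcal{L}_0}$ is the set of unitaries $U$ on $\mathcal{H}$ such that $P_0U|_{\mathcal{L}_0}:\mathcal{L}_0\to\mathcal{L}_0$ is Schmidt decomposable. Geodesics of the Grassmann manifold joining $\mathcal{L}_0$ to $\mathcal{L}=\delta(1)$ are the curves $\delta(t)=e^{itZ}\mathcal{L}_0$ with $Z=Z^*$ bounded, $\|Z\|\le\pi/2$, and $Z$ co-diagonal, i.e. $P_0ZP_0=0=(1-P_0)Z(1-P_0)$. The generic part of the pair $\mathcal{L}_0,\mathcal{L}$ is the orthogonal complement $\mathcal{H}'$ of $(\mathcal{L}_0\cap\mathcal{L})\oplus(\mathcal{L}_0^\perp\cap\mathcal{L}^\perp)\oplus(\mathcal{L}_0\cap\mathcal{L}^\perp)\oplus(\mathcal{L}_0^\perp\cap\mathcal{L})$; it reduces $Z$, and the generic part of $Z$ is $Z'=Z|_{\mathcal{H}'}$ with $\mathcal{L}=\delta(1)$. (In Halmos' model $\mathcal{H}'\simeq\mathcal{K}\times\mathcal{K}$ of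 the pair $P_0,P_{\mathcal{L}}$, in which $P_0$ becomes $\begin{pmatrix}1&0\\0&0\end{pmatrix}$ and $P_{\mathcal{L}}$ becomes $\begin{pmatrix}C^2&CS\\ CS&S^2\end{pmatrix}$ with $C=\cos X$, $S=\sin X$, $0\le X\le\pi/2$, one has $Z'=\begin{pmatrix}0&iX\\-iX&0\end{pmatrix}$.) *)

(* Defs.v *)
From HB Require Import structures.
From mathcomp Require Import all_boot all_order all_algebra complex.
From mathcomp Require Import all_classical all_reals all_analysis.

Set Implicit Arguments.
Unset Strict Implicit.
Unset Printing Implicit Defensive.

Import Order.TTheory GRing.Theory Num.Theory.
Import numFieldNormedType.Exports.

Local Open Scope classical_set_scope.
Local Open Scope complex_scope.
Local Open Scope ring_scope.

(* Complex Hilbert spaces.  The norm of a [normedModType R[i]] takes its values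
   in [R[i]]; [inner] is linear in its first argument. *)
HB.mixin Record CompleteNormedModule_isHilbert (R : realType) H
    & CompleteNormedModule R[i] H := {
  inner : H -> H -> R[i] ;
  inner_linearl : forall y, scalar (inner^~ y) ;
  innerC : forall x y, inner y x = (inner x y)^* ;
  inner_norm : forall x, inner x x = `|x| ^+ 2 }.

#[short(type="hilbertType")]
HB.structure Definition Hilbert (R : realType) :=
  {H of CompleteNormedModule_isHilbert R H & CompleteNormedModule R[i] H}.

Section Operators.
Context {R : realType} {H : hilbertType R}.
Implicit Types (S L M B : set H) (T U : H -> H) (x y z f g h : H) (t : R).

Definition separable_space := exists2 A : set H, countable A & dense A.

Definition closed_subspace S := submod_closed (mem S) /\ closed S.

Definition closed_span S := smallest closed_subspace S.

Definition orthocompl S := [set x | forall y, S y -> inner x y = 0].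

Definition set_sum S M := [set x + y | x in S & y in M].

(* Every [x] has such a [y], and only one, when [S] is a closed subspace. *)
Definition orthproj S x := xget 0 [set y | S y /\ orthocompl S (x - y)].

Definition orthonormal_set B :=
  forall x y, B x -> B y -> inner x y = (x == y)%:R.

Definition orthonormal_basis M B := orthonormal_set B /\ closed_span B = M.

Definition eigenvector T x := x != 0 /\ exists a : R[i], T x = a *: x.

(* [F] is a family of operators on the closed subspace [M]. *)
Definition simultaneously_diagonalizable_on M (F : set (H -> H)) :=
  exists2 B, orthonormal_basis M B &
    forall T x, F T -> B x -> eigenvector T x.

Definition diagonalizable_on M T := simultaneously_diagonalizable_on M [set T].

Definition selfadjoint T := forall x y, inner (T x) y = inner x (T y).

Definition unitary U :=
  [/\ linear U, forall x y, inner (U x) (U y) = inner x y & set_surj setT setT U].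

(* Equal to [+oo] when [T] is unbounded. *)
Definition opnorm T : \bar R :=
  ereal_sup [set (complex.Re `|T x|)%:E | x in [set x | `|x| <= 1]].

(* The exponential series of a bounded operator converges in norm, hence
   pointwise to the same operator. *)
Definition expop T x : H :=
  limn (series (fun n => (n`!%:R : R[i])^-1 *: iter n T x)).

Definition expi t T := expop (fun x => ('i * t%:C) *: T x).

Definition op_commutator T U x := T (U x) - U (T x).

Definition codiagonal L T :=
  let P := orthproj L in let Q x := x - P x in
  (forall x, P (T (P x)) = 0) /\ (forall x, Q (T (Q x)) = 0).

Definition rank_one f g h := inner h g *: f.

Definition orthonormal_system M (D : set nat) (f : nat -> H) :=
  (forall n, D n -> M (f n)) /\
  (forall m n, D m -> D n -> inner (f m) (f n) = (m == n)%:R).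

(* [T] is regarded as an operator on the closed subspace [M]; the systems are
   indexed by a set [D] of integers, so that they can be finite or infinite. *)
Definition schmidt_decomposable M T :=
  exists (D : set nat) (f g : nat -> H) (s : nat -> R),
    [/\ orthonormal_system M D f, orthonormal_system M D g,
        forall n, D n -> 0 < s n &
        forall h, M h ->
          \sum_(0 <= k < n | k \in D) (s k)%:C *: rank_one (f k) (g k) h
            @[n --> \oo] --> T h].

Definition Sd L : set (H -> H) :=
  [set U | unitary U /\ schmidt_decomposable L (orthproj L \o U)].

Definition geodesic L T t : set H := expi t T @` L.

Definition generic_part L M : set H :=
  orthocompl
    (set_sum (set_sum (L `&` M) (orthocompl L `&` orthocompl M))
             (set_sum (L `&` orthocompl M) (orthocompl L `&` M))).

End Operators.

Arguments separable_space {R} H.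

(* Main.v *)
Require Import Defs.
From HB Require Import structures.
From mathcomp Require Import all_boot all_order all_algebra complex.
From mathcomp Require Import all_classical all_reals all_analysis.
From mathcomp Require Import ring lra.

Set Implicit Arguments.
Unset Strict Implicit.
Unset Printing Implicit Defensive.

Import Order.TTheory GRing.Theory Num.Theory.
Import numFieldNormedType.Exports.

Local Open Scope classical_set_scope.
Local Open Scope ring_scope.

(** The theorem reduces to a single condition on [Z]: the eigenvectors of [Z]
    span a dense subspace of the whole space, written [pp_space Z = setT] below.
    Each of the three statements is equivalent to it.

    Since [Z] exchanges the closed subspace [L] and its complement, the symmetry
    [J = 2P - 1] satisfies [J Z = - Z J], hence [J exp(itZ) = exp(-itZ) J].  So
    [cos tZ] commutes with the projection [P], [sin tZ] exchanges [L] and its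
    complement, and the compression of [exp(itZ)] to [L] is the self-adjoint
    operator [cos tZ].

    From Schmidt to eigenvectors.  If a self-adjoint [C] has the expansion
    [C = sum s_n f_n (x) g_n] then [C g_n = s_n f_n] and [C f_n = s_n g_n], so
    [g_n + f_n] and [g_n - f_n] are eigenvectors of [C] and [C] vanishes on the
    vectors orthogonal to all of them ([schmidt_eigenvectors]).  The main point is
    then to pass from eigenvectors of [cos tZ], for one [t <> 0], to eigenvectors
    of [Z]; this is done without spectral theory.
    - If [T] is self-adjoint, every eigenvector of [T^2] is a sum of eigenvectors
      of [T] ([square_eigenvector]).  As [cos 2tZ = 2 (cos tZ)^2 - 1], it is
      enough to treat small [t].
    - For small [t] the operator [cos tZ] is close to the identity, so every
      eigenvector of [cos 2tZ] is already one of [cos tZ] ([opcos_halving]).  Thus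
      an eigenvector [e] of [cos tZ] is an eigenvector of [cos (t/2^k)Z] for all
      [k], and [Z^2 e], the limit of the vectors [2 (e - cos(s Z) e) / s^2] with
      [s = t/2^k], stays on the line of [e] ([sqr_eigen_of_opcos]).
    - So [e] is an eigenvector of [Z^2], and therefore a sum of eigenvectors of
      [Z] ([opcos_eigvecs_pp]).
    A vector orthogonal to all eigenvectors of [Z] then has a vanishing component
    in [L], and the same holds for its image by [Z]; so it lies in the kernel of
    [Z] and is zero ([pp_of_Sd]).

    From eigenvectors to Schmidt.  A self-adjoint operator with a total set of
    eigenvectors admits an orthonormal eigenbasis in every closed invariant
    subspace ([orthonormal_eigenbasis]).  Applied to [cos tZ] on [L], with a basis
    that is countable by separability, this gives the Schmidt decomposition, with
    [s_n] the absolute values of the eigenvalues ([Sd_of_pp]).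

    The generic part.  A vector [x] of [L] belongs to [exp(iZ) L] iff
    [sin(Z) x = 0], and to its complement iff [cos(Z) x = 0]; likewise with [L] and
    its complement exchanged.  Hence the four pieces removed from the space lie in the
    kernels of [sin Z] and [cos Z].  These consist of eigenvectors of some
    [cos tZ], so they are spanned by eigenvectors of [Z] ([nongeneric_pp]), and
    [Z] has a total set of eigenvectors iff its generic part has one.

    Finally [[P, P_t] = -i sin(tZ) cos(tZ)] for the projection [P_t] on
    [exp(itZ) L], so an eigenbasis of [Z] diagonalizes every exponential and every
    commutator ([eigvecs_commutator]). *)

(** * Real-valued norms and sequential limits *)

Section RealNorm.
Context {R : realType}.

(** Norms over [R[i]] take values in [R[i]]; all estimates are made in [R]. *)
Definition rnorm {V : normedZmodType R[i]} (x : V) : R := complex.Re `|x|.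

Lemma rnormE (V : normedZmodType R[i]) (x : V) : `|x| = (rnorm x)%:C%C.
Proof. by have /ger0_Im := normr_ge0 x; rewrite /rnorm; case: `|x| => a b /= ->. Qed.

Lemma rnorm_ge0 (V : normedZmodType R[i]) (x : V) : 0 <= rnorm x.
Proof. by have := normr_ge0 x; rewrite rnormE lecR. Qed.

Lemma rnorm0 (V : normedZmodType R[i]) : rnorm (0 : V) = 0.
Proof. by rewrite /rnorm normr0. Qed.

Lemma rnorm0_eq0 (V : normedZmodType R[i]) (x : V) : rnorm x = 0 -> x = 0.
Proof. by move=> x0; apply/eqP; rewrite -normr_eq0 rnormE x0. Qed.

Lemma rnormN (V : normedZmodType R[i]) (x : V) : rnorm (- x) = rnorm x.
Proof. by rewrite /rnorm normrN. Qed.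

Lemma rnormBC (V : normedZmodType R[i]) (x y : V) : rnorm (x - y) = rnorm (y - x).
Proof. by rewrite -rnormN opprB. Qed.

Lemma ler_rnormD (V : normedZmodType R[i]) (x y : V) :
  rnorm (x + y) <= rnorm x + rnorm y.
Proof. by have := ler_normD x y; rewrite !rnormE -rmorphD /= lecR. Qed.

Lemma ler_rnormB (V : normedZmodType R[i]) (x y : V) :
  rnorm (x - y) <= rnorm x + rnorm y.
Proof. by rewrite -(rnormN y); exact: ler_rnormD. Qed.

Lemma ler_rnorm_sum (V : normedZmodType R[i]) I (r : seq I) (P : pred I) (F : I -> V) :
  rnorm (\sum_(i <- r | P i) F i) <= \sum_(i <- r | P i) rnorm (F i).
Proof.
elim/big_rec2: _ => [|i b a _ ab]; first by rewrite rnorm0.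
by rewrite (le_trans (ler_rnormD _ _)) ?lerD2l.
Qed.

Lemma rnormZ (V : normedModType R[i]) a (x : V) : rnorm (a *: x) = rnorm a * rnorm x.
Proof. by apply: (@complexI R); rewrite rmorphM /= -!rnormE normrZ. Qed.

Lemma rnormM (a b : R[i]) : rnorm (a * b) = rnorm a * rnorm b.
Proof. by apply: (@complexI R); rewrite rmorphM /= -!rnormE normrM. Qed.

Lemma rnormX (a : R[i]) n : rnorm (a ^+ n) = rnorm a ^+ n.
Proof. by apply: (@complexI R); rewrite rmorphXn /= -!rnormE normrX. Qed.

Lemma rnorm_real (a : R) : rnorm a%:C%C = `|a|.
Proof.
by apply: (@complexI R); rewrite -!rnormE normc_def /= expr0n addr0 sqrtr_sqr.
Qed.

Lemma rnormV (a : R[i]) : rnorm a^-1 = (rnorm a)^-1.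
Proof. by apply: (@complexI R); rewrite fmorphV /= -!rnormE normfV. Qed.

Lemma rnormi : rnorm ('i : R[i]) = 1.
Proof. by apply: (@complexI R); rewrite -rnormE normCi. Qed.

Lemma cvg_rnormP (V : normedModType R[i]) (u : nat -> V) l :
  u @ \oo --> l <-> rnorm (u n - l) @[n --> \oo] --> (0 : R).
Proof.
split=> [/cvgrPdist_lt ul|/cvgrPdist_lt ul]; apply/cvgrPdist_lt => e e0.
  have : 0 < e%:C%C by rewrite ltcR.
  move=> /ul; apply: filterS => n.
  by rewrite distrC rnormE ltcR sub0r normrN ger0_norm ?rnorm_ge0.
move: e0; rewrite ltcE => /andP[/eqP e0i e0r] /=.
have := ul _ e0r; apply: filterS => n.
rewrite sub0r normrN ger0_norm ?rnorm_ge0 // => lt_e.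
by rewrite distrC rnormE ltcE /= lt_e e0i eqxx.
Qed.

Lemma cvg_dominated (V : normedModType R[i]) (u : nat -> V) l (v : nat -> R) :
  (forall n, rnorm (u n - l) <= v n) -> v @ \oo --> (0 : R) -> u @ \oo --> l.
Proof.
move=> uv v0; apply/cvg_rnormP; apply: (squeeze_cvgr _ (cvg_cst _) v0).
by apply: nearW => n; rewrite rnorm_ge0 uv.
Qed.

(** Sequences suffice because the balls of radius [1/(n+1)] form a countable
    base of neighbourhoods. *)
Lemma closed_seq (V : normedModType R[i]) (S : set V) :
  (forall u l, (forall n, S (u n)) -> u @ \oo --> l -> S l) -> closed S.
Proof.
move=> seqS x clx.
have near_x n : exists y, S y /\ rnorm (y - x) < n.+1%:R^-1.
  have e0 : 0 < (n.+1%:R^-1 : R)%:C%C by rewrite ltcR invr_gt0.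
  have [y [Sy]] := clx _ (nbhsx_ballx x _ e0).
  by rewrite -ball_normE /= rnormE ltcR rnormBC; exists y.
have [u us] := choice near_x.
apply: (seqS u) => [n|]; first by case: (us n).
apply: (@cvg_dominated _ _ _ harmonic) => [n|]; last exact: cvg_harmonic.
by case: (us n) => _ /ltW.
Qed.

Lemma cauchy_rnorm (V : completeNormedModType R[i]) (u : nat -> V) :
  (forall e : R, 0 < e -> exists N, forall m n, (N <= m)%N -> (N <= n)%N ->
     rnorm (u m - u n) < e) -> cvg (u @ \oo).
Proof.
move=> uC; apply/cauchy_cvgP; apply: cauchy_exP => e e0.
have er : e = (complex.Re e)%:C%C by have /ltW/ger0_Im := e0; case: e {e0} => a b /= ->.
move: e0; rewrite er ltcR => /uC[N NP]; exists (u N).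
exists N => // n /= Nn; rewrite -ball_normE /= rnormE ltcR.
exact: NP.
Qed.

End RealNorm.

(** * Inner products and orthogonal projections *)

Section InnerProduct.
Context {R : realType} {H : hilbertType R}.
Implicit Types (x y z : H) (a b : R[i]) (S : set H).

Lemma innerPl a x y z : inner (a *: x + y) z = a * inner x z + inner y z.
Proof. exact: inner_linearl. Qed.

Lemma innerDl x y z : inner (x + y) z = inner x z + inner y z.
Proof. by rewrite -[x]scale1r innerPl mul1r scale1r. Qed.

Lemma inner0l y : inner 0 y = 0.
Proof. by apply: (addrI (inner 0 y)); rewrite -innerDl !addr0. Qed.

Lemma innerZl a x y : inner (a *: x) y = a * inner x y.
Proof. by rewrite -[a *: x]addr0 innerPl inner0l addr0. Qed.

Lemma innerNl x y : inner (- x) y = - inner x y.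
Proof. by rewrite -scaleN1r innerZl mulN1r. Qed.

Lemma innerBl x y z : inner (x - y) z = inner x z - inner y z.
Proof. by rewrite innerDl innerNl. Qed.

Lemma innerDr x y z : inner x (y + z) = inner x y + inner x z.
Proof. by rewrite innerC innerDl rmorphD /= -!innerC. Qed.

Lemma innerZr a x y : inner x (a *: y) = a^* * inner x y.
Proof. by rewrite innerC innerZl rmorphM /= -innerC. Qed.

Lemma inner0r x : inner x 0 = 0.
Proof. by rewrite innerC inner0l rmorph0. Qed.

Lemma innerNr x y : inner x (- y) = - inner x y.
Proof. by rewrite innerC innerNl rmorphN /= -innerC. Qed.

Lemma innerBr x y z : inner x (y - z) = inner x y - inner x z.
Proof. by rewrite innerDr innerNr. Qed.

Lemma inner_suml I (r : seq I) (P : pred I) (F : I -> H) y :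
  inner (\sum_(i <- r | P i) F i) y = \sum_(i <- r | P i) inner (F i) y.
Proof.
by elim/big_rec2: _ => [|i b c _ bc]; rewrite ?inner0l // innerDl bc.
Qed.

Lemma inner_sumr I (r : seq I) (P : pred I) (F : I -> H) y :
  inner y (\sum_(i <- r | P i) F i) = \sum_(i <- r | P i) inner y (F i).
Proof.
by elim/big_rec2: _ => [|i b c _ bc]; rewrite ?inner0r // innerDr bc.
Qed.

Lemma inner_eq0C x y : inner x y = 0 -> inner y x = 0.
Proof. by move=> xy; rewrite innerC xy rmorph0. Qed.

Lemma inner_rnorm x : inner x x = (rnorm x ^+ 2)%:C%C.
Proof. by rewrite inner_norm rnormE rmorphXn. Qed.

Lemma inner0_eq0 x : inner x x = 0 -> x = 0.
Proof.
by rewrite inner_norm => /eqP; rewrite expf_eq0 /= normr_eq0 => /eqP.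
Qed.

Lemma parallelogram x y :
  rnorm (x + y) ^+ 2 + rnorm (x - y) ^+ 2 = 2 * (rnorm x ^+ 2 + rnorm y ^+ 2).
Proof.
apply: (@complexI R).
rewrite rmorphM rmorph_nat !rmorphD /= -!inner_rnorm !(innerDl, innerNl, innerDr, innerNr).
by ring.
Qed.

Lemma pythagoras x y : inner x y = 0 ->
  rnorm (x + y) ^+ 2 = rnorm x ^+ 2 + rnorm y ^+ 2.
Proof.
move=> xy; apply: (@complexI R); rewrite rmorphD /= -!inner_rnorm.
by rewrite innerDl !innerDr xy (inner_eq0C xy) addr0 add0r.
Qed.

Lemma cauchy_schwarz x y : rnorm (inner x y) <= rnorm x * rnorm y.
Proof.
have [y0|y0] := eqVneq (rnorm y) 0.
  by rewrite (rnorm0_eq0 y0) inner0r !rnorm0 mulr0.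
pose c := inner x y / inner y y.
have yy : inner y y != 0.
  by apply: contra_neq y0 => /inner0_eq0 ->; rewrite rnorm0.
have orth : inner (c *: y) (x - c *: y) = 0.
  apply: inner_eq0C.
  by rewrite innerBl !innerZr innerZl -mulrBr divfK // subrr mulr0.
have := pythagoras orth; rewrite addrC subrK => xE.
rewrite -(@ler_pXn2r _ 2) ?nnegrE ?mulr_ge0 ?rnorm_ge0 // exprMn xE.
rewrite mulrDl ler_wpDr ?mulr_ge0 ?exprn_ge0 ?rnorm_ge0 //.
rewrite rnormZ rnormM rnormV inner_rnorm rnorm_real.
rewrite ger0_norm ?exprn_ge0 ?rnorm_ge0 // le_eqVlt; apply/orP; left.
by apply/eqP; field.
Qed.

(** Both sides are limits of the common values, by the Cauchy-Schwarz
    inequality; this is how identities between partial sums pass to their limits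
    without a topology on the scalars. *)
Lemma inner_lim_eq (u v : nat -> H) l m x y :
  u @ \oo --> l -> v @ \oo --> m ->
  (forall n, inner (u n) y = inner x (v n)) -> inner l y = inner x m.
Proof.
move=> /cvg_rnormP ul /cvg_rnormP vm uv; apply/eqP; rewrite -subr_eq0.
apply/eqP; apply: (@rnorm0_eq0 R R[i]); apply/eqP; rewrite eq_le rnorm_ge0 andbT.
have c0 : rnorm (u n - l) * rnorm y + rnorm (v n - m) * rnorm x @[n --> \oo] --> (0 : R).
  have := cvgD (cvgM ul (cvg_cst (rnorm y))) (cvgM vm (cvg_cst (rnorm x))).
  by rewrite !mul0r addr0; exact.
apply: (ler_cvg_to (cvg_cst _) c0); apply: nearW => n.
have -> : inner l y - inner x m = inner x (v n - m) - inner (u n - l) y.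
  by rewrite innerBl innerBr uv; ring.
rewrite (le_trans (ler_rnormB _ _)) // addrC lerD ?cauchy_schwarz //.
by rewrite mulrC cauchy_schwarz.
Qed.

End InnerProduct.

Section Subspaces.
Context {R : realType} {H : hilbertType R}.
Implicit Types (x y z : H) (a b : R[i]) (S M : set H).

Lemma subspace0 S : closed_subspace S -> S 0.
Proof. by move=> [[S0 _] _]; rewrite inE in S0. Qed.

Lemma subspaceP S a x y : closed_subspace S -> S x -> S y -> S (a *: x + y).
Proof.
by move=> [[_ SP] _] Sx Sy; have := SP a x y; rewrite !inE; exact.
Qed.

Lemma subspaceD S x y : closed_subspace S -> S x -> S y -> S (x + y).
Proof. by move=> cS Sx Sy; rewrite -[x]scale1r; exact: subspaceP. Qed.

Lemma subspaceZ S a x : closed_subspace S -> S x -> S (a *: x).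
Proof. by move=> cS Sx; rewrite -[a *: x]addr0; apply: subspaceP => //; exact: subspace0. Qed.

Lemma subspaceB S x y : closed_subspace S -> S x -> S y -> S (x - y).
Proof. by move=> cS Sx Sy; rewrite -scaleN1r; apply: subspaceD => //; exact: subspaceZ. Qed.

Lemma subspace_sum S I (r : seq I) (P : pred I) (F : I -> H) :
  closed_subspace S -> (forall i, P i -> S (F i)) -> S (\sum_(i <- r | P i) F i).
Proof.
move=> cS SF; elim/big_rec: _ => [|i x Pi Sx]; first exact: subspace0.
by apply: subspaceD => //; exact: SF.
Qed.

Lemma subspace_lim S u l :
  closed_subspace S -> (forall n, S (u n)) -> u @ \oo --> l -> S l.
Proof. by move=> [_ clS] Su; apply: (closed_cvg _ clS); exact: nearW. Qed.

Lemma closed_subspaceI S : S 0 ->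
  (forall a x y, S x -> S y -> S (a *: x + y)) ->
  (forall u l, (forall n, S (u n)) -> u @ \oo --> l -> S l) -> closed_subspace S.
Proof.
move=> S0 SP Sl; split; last exact: closed_seq.
by split=> [|a x y]; rewrite !inE //; exact: SP.
Qed.

Lemma closed_span_subspace S : closed_subspace (closed_span S).
Proof.
apply: closed_subspaceI.
- by move=> A [cA _]; exact: subspace0.
- by move=> a x y Sx Sy A /[dup] [[cA _]] AP; apply: subspaceP => //; [exact: Sx|exact: Sy].
- by move=> u l Su ul A /[dup] [[cA _]] AP; apply: subspace_lim ul => // n; exact: Su.
Qed.

Lemma sub_closed_span S : S `<=` closed_span S.
Proof. by move=> x Sx A [_]; exact. Qed.

Lemma closed_span_min S M : closed_subspace M -> S `<=` M -> closed_span S `<=` M.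
Proof. by move=> cM SM x; exact. Qed.

Lemma orthocompl_subspace S : closed_subspace (orthocompl S).
Proof.
apply: closed_subspaceI.
- by move=> y _; exact: inner0l.
- by move=> a x y Sx Sy z Sz; rewrite innerPl Sx // Sy // mulr0 addr0.
- move=> u l Su ul y Sy; rewrite -[RHS](inner0r (0 : H)).
  by apply: (inner_lim_eq ul (cvg_cst 0)) => n; rewrite inner0r Su.
Qed.

Lemma orthocompl_disjoint S x : S x -> orthocompl S x -> x = 0.
Proof. by move=> Sx oSx; apply: inner0_eq0; exact: oSx. Qed.

Lemma orthocompl_closed_span S : orthocompl (closed_span S) = orthocompl S.
Proof.
apply/seteqP; split=> x ox y Sy; first by apply: ox; exact: sub_closed_span.
suff /(_ x erefl)/inner_eq0C : orthocompl [set x] y by [].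
apply: (closed_span_min (orthocompl_subspace _) _ Sy) => z Sz _ ->.
exact/inner_eq0C/ox.
Qed.

(** A minimizing sequence for the distance to [S] is Cauchy by the
    parallelogram law, since the midpoint of two of its terms is in [S]; its limit
    realizes the distance, and moving it along a vector [z] of [S] would decrease
    this distance unless [x - y] is orthogonal to [z]. *)
Lemma projection_exists S x : closed_subspace S ->
  exists y, S y /\ orthocompl S (x - y).
Proof.
move=> cS; pose D := [set rnorm (x - y) | y in S].
have D0 : D !=set0 by exists (rnorm (x - 0)), 0 => //; exact: subspace0.
have Dlb : has_lbound D by exists 0 => _ [y _ <-]; exact: rnorm_ge0.
pose d := inf D.
have d_le y : S y -> d <= rnorm (x - y) by move=> Sy; apply: ge_inf => //; exists y.
have d_ge0 : 0 <= d by apply: lb_le_inf => // _ [y _ <-]; exact: rnorm_ge0.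
have near_d n : exists y, S y /\ rnorm (x - y) < d + n.+1%:R^-1.
  have [_ [y Sy <-] ylt] : exists2 r, D r & r < d + n.+1%:R^-1.
    by apply: inf_adherent; rewrite ?invr_gt0.
  by exists y.
have [u us] := choice near_d.
(* The constant bounds [2 ((d + a)^2 + (d + b)^2) - 4 d^2] for [0 <= a, b <= 1]. *)
have u_dist m n : rnorm (u m - u n) ^+ 2 <=
    (4 * d + 2) * (m.+1%:R^-1 + n.+1%:R^-1).
  have [Sm lm] := us m; have [Sn ln] := us n.
  have Smid : S (2^-1 *: (u m + u n)) by apply: subspaceZ => //; exact: subspaceD.
  have := parallelogram (x - u m) (x - u n).
  have -> : x - u m - (x - u n) = - (u m - u n).
    by rewrite !opprB addrC addrA subrK addrC.
  have -> : x - u m + (x - u n) = 2 *: (x - 2^-1 *: (u m + u n)).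
    rewrite scalerBr scalerA mulfV ?pnatr_eq0 // scale1r scaler_nat mulr2n.
    by rewrite addrACA opprD.
  rewrite rnormN rnormZ.
  have -> : rnorm (2 : R[i]) = 2.
    have -> : (2 : R[i]) = (2 : R)%:C%C by rewrite rmorph_nat.
    by rewrite rnorm_real ger0_norm.
  have := d_le _ Smid.
  have : (m.+1%:R^-1 : R) <= 1 by rewrite invf_le1 ?ler1n ?ltr0n.
  have : (n.+1%:R^-1 : R) <= 1 by rewrite invf_le1 ?ler1n ?ltr0n.
  have : 0 <= (m.+1%:R^-1 : R) by rewrite invr_ge0.
  have : 0 <= (n.+1%:R^-1 : R) by rewrite invr_ge0.
  have := rnorm_ge0 (x - u m); have := rnorm_ge0 (x - u n).
  move: lm ln d_ge0.
  move: (rnorm (x - u m)) (rnorm (x - u n)) (rnorm (x - 2^-1 *: (u m + u n)))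
    (rnorm (u m - u n)) => p q r s.
  move: (m.+1%:R^-1) (n.+1%:R^-1) => e f lp lq d0 p0 q0 f0 e0 f1 e1 dr sE.
  have p2 : p ^+ 2 <= (d + e) ^+ 2 by rewrite ler_sqr ?nnegrE; lra.
  have q2 : q ^+ 2 <= (d + f) ^+ 2 by rewrite ler_sqr ?nnegrE; lra.
  have r2 : d ^+ 2 <= r ^+ 2 by rewrite ler_sqr ?nnegrE; lra.
  have e2 : e ^+ 2 <= e by rewrite expr2 ler_piMr.
  have f2 : f ^+ 2 <= f by rewrite expr2 ler_piMr.
  nra.
have u_cvg : cvg (u @ \oo).
  apply: cauchy_rnorm => e e0.
  have e2 : 0 < e ^+ 2 / (4 * d + 2) / 2 by rewrite !divr_gt0 ?exprn_gt0 //; lra.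
  have := @cvg_harmonic R => /cvgrPdist_lt /(_ _ e2)[N _ NP]; exists N => m n Nm Nn.
  rewrite -(@ltr_pXn2r _ 2) ?nnegrE ?rnorm_ge0 ?(ltW e0) //.
  apply: (le_lt_trans (u_dist m n)).
  rewrite mulrC -ltr_pdivlMr; last by lra.
  have := NP _ Nm; have := NP _ Nn.
  rewrite !sub0r !normrN !ger0_norm ?invr_ge0 //=.
  move: (e ^+ 2 / (4 * d + 2)) (m.+1%:R^-1) (n.+1%:R^-1) => w a b; lra.
pose y := lim (u @ \oo).
have Sy : S y by apply: subspace_lim u_cvg => // n; case: (us n).
have xy : rnorm (x - y) <= d.
  have /cvg_rnormP uy : u @ \oo --> y by [].
  have c0 : d + n.+1%:R^-1 + rnorm (u n - y) @[n --> \oo] --> (d : R).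
    rewrite -[X in _ --> X]addr0 -[X in X + _]addr0.
    by apply: cvgD => //; apply: cvgD; [exact: cvg_cst|exact: cvg_harmonic].
  apply: (ler_cvg_to (cvg_cst _) c0); apply: nearW => n /=.
  have -> : x - y = (x - u n) + (u n - y) by rewrite addrA subrK.
  by rewrite (le_trans (ler_rnormD _ _)) // lerD2r; case: (us n) => _ /ltW.
exists y; split=> // z Sz.
have [z0|z0] := eqVneq (rnorm z) 0; first by rewrite (rnorm0_eq0 z0) inner0r.
have zz : inner z z != 0.
  by apply: contra_neq z0 => /inner0_eq0 ->; rewrite rnorm0.
pose c := inner (x - y) z / inner z z.
have orth : inner (x - y - c *: z) (c *: z) = 0.
  by rewrite innerZr innerBl innerZl divfK // subrr mulr0.
have := pythagoras orth; rewrite subrK => xE.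
have : d ^+ 2 <= rnorm (x - y - c *: z) ^+ 2.
  rewrite ler_sqr ?nnegrE ?rnorm_ge0 // -addrA -opprD d_le //.
  by apply: subspaceD => //; exact: subspaceZ.
have : rnorm (x - y) ^+ 2 <= d ^+ 2 by rewrite ler_sqr ?nnegrE ?rnorm_ge0.
rewrite xE => le1 le2.
have : rnorm (c *: z) ^+ 2 = 0.
  by apply/eqP; rewrite eq_le exprn_ge0 ?rnorm_ge0 // andbT; lra.
move/eqP; rewrite expf_eq0 /= rnormZ mulf_eq0 (negbTE z0) orbF => /eqP.
by move/rnorm0_eq0/eqP; rewrite mulf_eq0 invr_eq0 (negbTE zz) orbF => /eqP.
Qed.

Lemma orthoprojP S x : closed_subspace S ->
  S (orthproj S x) /\ orthocompl S (x - orthproj S x).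
Proof. by move=> /(projection_exists x); exact: xgetPex. Qed.

Lemma orthproj_unique S x y : closed_subspace S ->
  S y -> orthocompl S (x - y) -> orthproj S x = y.
Proof.
move=> cS Sy oy; have [Sp op] := orthoprojP x cS; apply/eqP; rewrite -subr_eq0.
apply/eqP; apply: (@orthocompl_disjoint S); first exact: subspaceB.
have -> : orthproj S x - y = (x - y) - (x - orthproj S x).
  by rewrite opprB [RHS]addrC addrA subrK.
by apply: (subspaceB (orthocompl_subspace S)).
Qed.

Lemma orthocomplK S : closed_subspace S -> orthocompl (orthocompl S) = S.
Proof.
move=> cS; apply/seteqP; split=> [x oox|x Sx y oy]; last exact/inner_eq0C/oy.
have [y [Sy oy]] := projection_exists x cS.
suff /eqP : x - y = 0 by rewrite subr_eq0 => /eqP ->.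
apply: (orthocompl_disjoint oy); apply: (subspaceB (orthocompl_subspace _)) => //.
by move=> z oz; apply/inner_eq0C/oz.
Qed.

End Subspaces.

Section Lines.
Context {R : realType} {H : hilbertType R}.

(** [line e (T e)] says that [e] is zero or an eigenvector of [T]. *)
Definition line (e : H) := [set x | exists a : R[i], x = a *: e].

(** A line is closed because it is a double orthogonal complement. *)
Lemma line_subspace e : closed_subspace (line e).
Proof.
suff -> : line e = orthocompl (orthocompl [set e]) by exact: orthocompl_subspace.
apply/seteqP; split=> [_ [a ->] y oy|x xoo].
  by rewrite innerZl (inner_eq0C (oy _ erefl)) mulr0.
have [e0|e0] := eqVneq e 0.
  exists 0; rewrite scale0r; apply: inner0_eq0; apply: xoo => _ ->.
  by rewrite e0 inner0r.
have ee : inner e e != 0 by apply: contra_neq e0 => /inner0_eq0.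
exists (inner x e / inner e e); apply/eqP; rewrite -subr_eq0; apply/eqP.
have o : inner (x - inner x e / inner e e *: e) e = 0.
  by rewrite innerBl innerZl divfK // subrr.
apply: inner0_eq0; rewrite innerBl innerZl (inner_eq0C o) mulr0 subr0.
by apply: xoo => _ ->.
Qed.

End Lines.

(** * Bounded operators *)

Section BoundedOperators.
Context {R : realType} {H : hilbertType R}.

Lemma cvg_seq_unique (u : nat -> H) (l m : H) :
  u @ \oo --> l -> u @ \oo --> m -> l = m.
Proof. by move=> ul um; apply: (cvg_unique (@norm_hausdorff _ H) ul um). Qed.

Lemma cvg_comb (a : R[i]) (u v : nat -> H) (l m : H) :
  u @ \oo --> l -> v @ \oo --> m -> a *: u n + v n @[n --> \oo] --> a *: l + m.
Proof.
move=> /cvg_rnormP ul /cvg_rnormP vm.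
apply: (@cvg_dominated _ _ _ _ (fun n => rnorm a * rnorm (u n - l) + rnorm (v n - m))).
  move=> n; rewrite opprD addrACA -scalerBr -rnormZ; exact: ler_rnormD.
have := cvgD (cvgM (cvg_cst (rnorm a)) ul) vm.
by rewrite mulr0 addr0; exact.
Qed.

Definition bounded_op (T : H -> H) :=
  exists2 M : R, 0 <= M & forall x, rnorm (T x) <= M * rnorm x.

Lemma bounded_op_cvg (T : {linear H -> H}) (u : nat -> H) l :
  bounded_op T -> u @ \oo --> l -> T (u n) @[n --> \oo] --> T l.
Proof.
move=> [M M0 TM] /cvg_rnormP ul.
apply: (@cvg_dominated _ _ _ _ (fun n => M * rnorm (u n - l))) => [n|].
  by rewrite -linearB TM.
have := cvgM (cvg_cst M) ul.
by rewrite mulr0; exact.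
Qed.

Lemma opnorm_bounded (T : {linear H -> H}) (B : R) :
  (opnorm T <= B%:E)%E -> bounded_op T.
Proof.
move=> TB; have T1 x : rnorm x <= 1 -> rnorm (T x) <= B.
  move=> x1; rewrite -lee_fin; apply: le_trans TB; apply: ereal_sup_ubound.
  by exists x => //=; rewrite rnormE lecR.
have B0 : 0 <= B by rewrite (le_trans _ (T1 0 _)) ?rnorm_ge0 ?rnorm0.
exists B => // x; have [x0|x0] := eqVneq (rnorm x) 0.
  by rewrite (rnorm0_eq0 x0) linear0 !rnorm0 mulr0.
have rx0 : 0 < rnorm x by rewrite lt0r x0 rnorm_ge0.
have := T1 ((rnorm x)^-1%:C%C *: x).
rewrite linearZ !rnormZ rnorm_real ger0_norm ?invr_ge0 ?rnorm_ge0 // mulVf //.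
by move=> /(_ (lexx _)); rewrite mulrC ler_pdivrMr.
Qed.

Lemma rnorm_lim_le (u : nat -> H) l y (B : R) N :
  u @ \oo --> l -> (forall n, (N <= n)%N -> rnorm (u n - y) <= B) ->
  rnorm (l - y) <= B.
Proof.
move=> /cvg_rnormP ul uB.
have c0 : B + rnorm (u n - l) @[n --> \oo] --> B.
  by have := cvgD (cvg_cst B) ul; rewrite addr0; exact.
apply: (ler_cvg_to (cvg_cst _) c0); exists N => // n /= Nn.
have -> : l - y = (u n - y) - (u n - l) by rewrite opprB [RHS]addrC addrA subrK.
by rewrite (le_trans (ler_rnormB _ _)) // lerD2r uB.
Qed.

Lemma dominated_series_cvg (u : nat -> H) (v : nat -> R) :
  (forall k, rnorm (u k) <= v k) -> cvgn (series v) -> cvgn (series u).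
Proof.
move=> uv /cauchy_cvgP/cauchy_seriesP vC; apply: cauchy_rnorm => e e0.
have [[A B] [[N1 _ AP] [N2 _ BP]] /= NP] := vC _ e0.
exists (maxn N1 N2).
have main m n : (maxn N1 N2 <= m)%N -> (m <= n)%N -> rnorm (series u n - series u m) < e.
  move=> Nm mn; rewrite sub_series_geq //.
  apply: (le_lt_trans (ler_rnorm_sum _ _ _)).
  have Am : A m by apply: AP; rewrite /= (leq_trans _ Nm) // leq_maxl.
  have Bn : B n by apply: BP; rewrite /= (leq_trans _ mn) // (leq_trans _ Nm) // leq_maxr.
  have := NP (m, n) (conj Am Bn); apply: le_lt_trans.
  by rewrite (le_trans _ (ler_norm _)) //; apply: ler_sum => k _; exact: uv.
move=> m n Nm Nn; have [mn|/ltnW nm] := leqP m n; last exact: main.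
by rewrite rnormBC main.
Qed.

End BoundedOperators.

(** * The exponential series of a bounded operator *)

Section TriangularSum.

(** The part of a square of indices beyond its diagonal is the error made in
    a Cauchy product; the same splitting serves for operators and for the real
    exponentials that dominate them. *)
Lemma sum_square_triangle (V : zmodType) (F : nat -> nat -> V) N :
  \sum_(0 <= i < N) \sum_(0 <= j < N) F i j =
  \sum_(0 <= n < N) \sum_(0 <= i < n.+1) F i (n - i)%N +
  \sum_(0 <= i < N) \sum_(0 <= j < N | (N <= i + j)%N) F i j.
Proof.
under eq_bigr => i _ do rewrite (bigID (fun j => (N <= i + j)%N)) /= addrC.
rewrite big_split /=; congr (_ + _).
transitivity (\sum_(0 <= i < N) \sum_(i <= n < N) F i (n - i)%N).
  apply: eq_big_nat => i /andP[_ iN].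
  have -> := big_addn 0 N i xpredT (fun n => F i (n - i)%N).
  rewrite (big_nat_widen 0 (N - i) N) ?leq_subr //.
  apply: eq_big => j; first by rewrite -ltnNge /= ltn_subRL.
  by rewrite addnK.
rewrite (eq_bigr (fun i => \sum_(0 <= n < N | (i <= n)%N) F i (n - i)%N)); last first.
  by move=> i _; rewrite (@big_nat_widenl _ _ _ i 0%N).
rewrite (exchange_big_dep_nat xpredT) //=.
apply: eq_big_nat => n /andP[_ nN].
by rewrite (big_nat_widen 0 n.+1 N).
Qed.

Lemma exp_coeff_convolution (K : numFieldType) (c d : K) n :
  \sum_(0 <= i < n.+1) c ^+ i / i`!%:R * (d ^+ (n - i) / (n - i)`!%:R) =
  (c + d) ^+ n / n`!%:R.
Proof.
rewrite addrC exprDn mulr_suml big_mkord; apply: eq_bigr => i _.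
have fE : (n`!%:R : K) = 'C(n, i)%:R * (i`!%:R * (n - i)`!%:R).
  by rewrite -!natrM bin_fact // -ltnS.
have f1 : (i`!%:R : K) != 0 by rewrite pnatr_eq0 -lt0n fact_gt0.
have f2 : ((n - i)`!%:R : K) != 0 by rewrite pnatr_eq0 -lt0n fact_gt0.
have f3 : ('C(n, i)%:R : K) != 0 by rewrite pnatr_eq0 -lt0n bin_gt0 -ltnS.
by rewrite fE -mulr_natl; field; rewrite f1 f2 f3.
Qed.

End TriangularSum.

Definition expterm {R : realType} {H : hilbertType R} (Z : H -> H) (c : R[i]) (x : H)
  (n : nat) : H := (c ^+ n / n`!%:R) *: iter n Z x.

(** Locked to keep the limit from being unfolded in conversion tests. *)
HB.lock Definition opexp {R : realType} {H : hilbertType R} (Z : H -> H) (c : R[i])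
  (x : H) : H := limn (series (expterm Z c x)).

Section Exponential.
Context {R : realType} {H : hilbertType R}.
Variable Z : {linear H -> H}.
Implicit Types (x y : H) (c d : R[i]).

Local Notation expterm := (expterm Z).
Local Notation opexp := (opexp Z).

Lemma expi_opexp (t : R) : expi t Z = opexp ('i * t%:C%C).
Proof.
apply/funext => x; rewrite /expi /expop opexp.unlock.
suff -> : (fun n : nat => (n`!%:R)^-1 *: iter n (fun x0 => ('i * t%:C%C) *: Z x0) x) =
  expterm ('i * t%:C%C) x by [].
apply/funext => n; rewrite /expterm [_ / n`!%:R]mulrC -scalerA; congr (_ *: _).
elim: n => [|n IHn]; first by rewrite expr0 scale1r.
by rewrite iterS IHn linearZ scalerA exprS.
Qed.

Lemma series_expterm1 c x : series (expterm c x) 1 = x.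
Proof. by rewrite seriesEnat /= big_nat1 /expterm expr0 fact0 divr1 scale1r. Qed.

Lemma series_expterm3 c x :
  series (expterm c x) 3 = x + c *: Z x + (c ^+ 2 / 2) *: Z (Z x).
Proof.
rewrite seriesEnat /= !big_nat_recr //= big_geq // add0r /expterm /=.
by congr (_ + _ + _); rewrite ?expr0 ?expr1 ?factS ?fact0 ?muln1 ?divr1 ?scale1r.
Qed.

Lemma iter_linear n a x y : iter n Z (a *: x + y) = a *: iter n Z x + iter n Z y.
Proof. by elim: n => //= n ->; rewrite linearP. Qed.

Lemma series_expterm_linear c n a x y :
  series (expterm c (a *: x + y)) n = a *: series (expterm c x) n + series (expterm c y) n.
Proof.
rewrite !seriesEnat /= scaler_sumr -big_split /=; apply: eq_bigr => k _.
by rewrite /expterm iter_linear scalerDr !scalerA [in RHS]mulrC.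
Qed.

Lemma series_exptermB c n x y :
  series (expterm c (x - y)) n = series (expterm c x) n - series (expterm c y) n.
Proof.
by rewrite addrC -scaleN1r series_expterm_linear scaleN1r addrC.
Qed.

Hypothesis Zb : bounded_op Z.

Lemma expterm_bound : exists2 M : R, 0 <= M & forall c x n,
  rnorm (expterm c x n) <= exp_coeff (rnorm c * M) n * rnorm x.
Proof.
have [M M0 ZM] := Zb; exists M => // c x n.
have itM : rnorm (iter n Z x) <= M ^+ n * rnorm x.
  elim: n => [|n IHn] /=; first by rewrite expr0 mul1r.
  by rewrite (le_trans (ZM _)) // exprS -mulrA ler_wpM2l.
rewrite /expterm /exp_coeff /= rnormZ rnormM rnormX rnormV.
have -> : rnorm (n`!%:R : R[i]) = n`!%:R.
  by rewrite -(rmorph_nat (real_complex R)) rnorm_real ger0_norm.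
rewrite exprMn -!mulrA ler_wpM2l ?exprn_ge0 ?rnorm_ge0 //.
by rewrite mulrCA ler_wpM2l ?invr_ge0 //.
Qed.

Lemma cvg_opexp c x : series (expterm c x) @ \oo --> opexp c x.
Proof.
have [M M0 bd] := expterm_bound; rewrite opexp.unlock.
apply: (dominated_series_cvg (bd c x)).
have -> : (fun k => exp_coeff (rnorm c * M) k * rnorm x) =
   rnorm x *: exp_coeff (rnorm c * M).
  by apply/funext => k; rewrite mulrC.
apply: is_cvg_seriesZ; exact: is_cvg_series_exp_coeff.
Qed.
Arguments cvg_opexp c x : clear implicits.

Lemma opexp_linear c a x y : opexp c (a *: x + y) = a *: opexp c x + opexp c y.
Proof.
apply: cvg_seq_unique (cvg_opexp c _) _.
have -> : series (expterm c (a *: x + y)) =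
    (fun n => a *: series (expterm c x) n + series (expterm c y) n).
  by apply/funext => n; exact: series_expterm_linear.
by apply: cvg_comb; exact: cvg_opexp.
Qed.

Lemma opexpD c x y : opexp c (x + y) = opexp c x + opexp c y.
Proof. by rewrite -[x]scale1r opexp_linear !scale1r. Qed.

Lemma opexp_vec0 c : opexp c 0 = 0.
Proof. by apply: (addrI (opexp c 0)); rewrite -opexpD !addr0. Qed.

Lemma opexpZ c a x : opexp c (a *: x) = a *: opexp c x.
Proof. by rewrite -[a *: x]addr0 opexp_linear opexp_vec0 addr0. Qed.

Lemma opexpB c x y : opexp c (x - y) = opexp c x - opexp c y.
Proof. by rewrite opexpD -scaleN1r opexpZ scaleN1r. Qed.

Lemma series_expterm_le c : exists2 B : R, 0 <= B &
  forall x n, rnorm (series (expterm c x) n) <= B * rnorm x.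
Proof.
have [M M0 bd] := expterm_bound.
have cM0 : 0 <= rnorm c * M by rewrite mulr_ge0 ?rnorm_ge0.
exists (expR (rnorm c * M)) => [|x n]; first exact: expR_ge0.
rewrite seriesEnat (le_trans (ler_rnorm_sum _ _ _)) //.
rewrite (@le_trans _ _ (series (exp_coeff (rnorm c * M)) n * rnorm x)) //.
  by rewrite seriesEnat /= mulr_suml ler_sum.
rewrite ler_wpM2r ?rnorm_ge0 //; apply: nondecreasing_cvgn_le.
  by apply: nondecreasing_series => k _ _; exact: exp_coeff_ge0.
exact: is_cvg_series_exp_coeff.
Qed.

Lemma opexp_bounded c : bounded_op (opexp c).
Proof.
have [B B0 SB] := series_expterm_le c; exists B => // x.
rewrite -[opexp c x]subr0; apply: (rnorm_lim_le (N := 0) (cvg_opexp c x)) => n _.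
by rewrite subr0.
Qed.

(** For [|c| <= 1] the remainder of order [n] is at most [|c|^n] times the
    exponential series of the bound of [Z]. *)
Lemma opexp_taylor : exists2 B : R, 0 <= B & forall c x n, rnorm c <= 1 ->
  rnorm (opexp c x - series (expterm c x) n) <= rnorm c ^+ n * (B * rnorm x).
Proof.
have [M M0 bd] := expterm_bound.
exists (expR M) => [|c x n c1]; first exact: expR_ge0.
apply: (rnorm_lim_le (N := n) (cvg_opexp c x)) => m nm.
rewrite sub_series_geq // (le_trans (ler_rnorm_sum _ _ _)) //.
rewrite (@le_trans _ _ (\sum_(n <= k < m) rnorm c ^+ n * (exp_coeff M k * rnorm x))) //.
  rewrite big_nat_cond [leRHS]big_nat_cond; apply: ler_sum => k /andP[/andP[nk _] _].
  rewrite (le_trans (bd _ _ _)) // mulrA ler_wpM2r ?rnorm_ge0 //.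
  rewrite /exp_coeff /= exprMn mulrA ler_wpM2r ?invr_ge0 //.
  rewrite ler_wpM2r ?exprn_ge0 //.
  by apply: ler_wiXn2l => //; exact: rnorm_ge0.
rewrite -mulr_sumr ler_wpM2l ?exprn_ge0 ?rnorm_ge0 // -mulr_suml ler_wpM2r ?rnorm_ge0 //.
rewrite (@le_trans _ _ (series (exp_coeff M) m)) //.
  rewrite seriesEnat /= (@big_cat_nat _ _ _ n 0%N m) //= lerDr sumr_ge0 // => k _.
  exact: exp_coeff_ge0.
apply: nondecreasing_cvgn_le; last exact: is_cvg_series_exp_coeff.
by apply: nondecreasing_series => k _ _; exact: exp_coeff_ge0.
Qed.

(** Used with [s = 1] for operators that commute with [Z], and with [s = -1]
    for a symmetry that anticommutes with [Z]. *)
Lemma opexp_intertwine (T : {linear H -> H}) (s : R[i]) c x : bounded_op T ->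
  (forall y, T (Z y) = s *: Z (T y)) -> T (opexp c x) = opexp (s * c) (T x).
Proof.
move=> Tb TZ.
apply: cvg_seq_unique (bounded_op_cvg Tb (cvg_opexp c x)) _.
suff -> : (fun n => T (series (expterm c x) n)) = series (expterm (s * c) (T x)).
  exact: cvg_opexp.
apply/funext => n; rewrite !seriesEnat /= linear_sum; apply: eq_bigr => k _.
rewrite /expterm linearZ /=.
have -> : T (iter k Z x) = s ^+ k *: iter k Z (T x).
  elim: k => [|k IHk]; first by rewrite expr0 scale1r.
  by rewrite iterS TZ IHk linearZ scalerA exprS.
by rewrite scalerA exprMn; congr (_ *: _); ring.
Qed.

Lemma opexp_comm c x : Z (opexp c x) = opexp c (Z x).
Proof.
rewrite (@opexp_intertwine Z 1) // ?mul1r // => y.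
by rewrite scale1r.
Qed.

Lemma opexp_adjoint c x y : selfadjoint Z ->
  inner (opexp c x) y = inner x (opexp c^* y).
Proof.
move=> Zs; apply: (inner_lim_eq (cvg_opexp c x) (cvg_opexp _ y)) => n.
rewrite !seriesEnat /= inner_suml inner_sumr; apply: eq_bigr => k _.
rewrite /expterm innerZl innerZr rmorphM rmorphXn fmorphV rmorph_nat /= conjCK.
congr (_ * _); elim: k y => //= k IHk y.
by rewrite Zs IHk -iterSr.
Qed.

Lemma opexp0 x : opexp 0 x = x.
Proof.
apply: cvg_seq_unique (cvg_opexp 0 x) _.
apply/cvg_rnormP; apply: cvg_near_cst; exists 1%N => // -[//|n] _ /=.
rewrite seriesEnat /= big_nat_recl // big1 => [|k _].
  by rewrite addr0 /expterm expr0 fact0 divr1 scale1r subrr rnorm0.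
by rewrite /expterm expr0n mul0r scale0r.
Qed.

Lemma opexp_eigen c (a : R[i]) e : Z e = a *: e -> line e (opexp c e).
Proof.
move=> Ze; apply: subspace_lim (cvg_opexp c e) => [|n]; first exact: line_subspace.
rewrite seriesEnat; apply: subspace_sum => [|k _]; first exact: line_subspace.
apply: subspaceZ; first exact: line_subspace.
exists (a ^+ k); elim: k => [|k IHk]; first by rewrite expr0 scale1r.
by rewrite iterS IHk linearZ /= Ze scalerA exprSr.
Qed.

Lemma expterm_sum c n I (r : seq I) (F : I -> H) :
  expterm c (\sum_(j <- r) F j) n = \sum_(j <- r) expterm c (F j) n.
Proof.
rewrite /expterm -scaler_sumr; congr (_ *: _).
by elim: n => //= n ->; exact: linear_sum.
Qed.

Lemma expterm_expterm c d x i j : expterm c (expterm d x j) i =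
  (c ^+ i / i`!%:R * (d ^+ j / j`!%:R)) *: iter (i + j) Z x.
Proof.
rewrite /expterm iterD -[in RHS]scalerA; congr (_ *: _).
by elim: i => //= i ->; rewrite linearZ.
Qed.

Lemma expterm_convolution c d x n :
  \sum_(0 <= i < n.+1) expterm c (expterm d x (n - i)) i = expterm (c + d) x n.
Proof.
rewrite /expterm -exp_coeff_convolution scaler_suml.
apply: eq_big_nat => i /andP[_]; rewrite ltnS => /subnKC iE.
by rewrite [LHS]expterm_expterm iE.
Qed.

Lemma series_expterm_comp c d N x :
  series (expterm c (series (expterm d x) N)) N =
  series (expterm (c + d) x) N +
  \sum_(0 <= i < N) \sum_(0 <= j < N | (N <= i + j)%N) expterm c (expterm d x j) i.
Proof.
rewrite !seriesEnat /=; under eq_bigr do rewrite expterm_sum.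
rewrite sum_square_triangle; congr (_ + _).
by apply: eq_bigr => n _; exact: expterm_convolution.
Qed.

(** Cauchy product: the error term is bounded by the corresponding error for
    the real exponential series, which tends to [exp a * exp b - exp (a + b) = 0]. *)
Lemma opexp_opexp c d x : opexp c (opexp d x) = opexp (c + d) x.
Proof.
pose u N := series (expterm c (series (expterm d x) N)) N.
apply: (@cvg_seq_unique _ _ u).
  have [B B0 SB] := series_expterm_le c.
  have /cvg_rnormP d1 := cvg_opexp c (opexp d x).
  have /cvg_rnormP d2 := cvg_opexp d x.
  apply: (@cvg_dominated _ _ _ _ (fun n =>
    rnorm (series (expterm c (opexp d x)) n - opexp c (opexp d x)) +
    B * rnorm (series (expterm d x) n - opexp d x))) => [n|].
    rewrite [leRHS]addrC; set w := opexp c _.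
    have -> : u n - w = series (expterm c (series (expterm d x) n - opexp d x)) n
        + (series (expterm c (opexp d x)) n - w).
      by rewrite series_exptermB addrA subrK.
    by rewrite (le_trans (ler_rnormD _ _)) // lerD2r.
  have := cvgD d1 (cvgM (cvg_cst B) d2).
  by rewrite mulr0 addr0; exact.
have [M M0 bd] := expterm_bound.
set a := rnorm c * M; set b := rnorm d * M.
have /cvg_rnormP d3 := cvg_opexp (c + d) x.
have sq0 : series (exp_coeff a) n * series (exp_coeff b) n - series (exp_coeff (a + b)) n
    @[n --> \oo] --> (0 : R).
  have ca (z : R) : series (exp_coeff z) @ \oo --> expR z by exact: is_cvg_series_exp_coeff.
  have := cvgB (cvgM (ca a) (ca b)) (ca (a + b)).
  by rewrite expRD subrr; exact.
apply: (@cvg_dominated _ _ _ _ (fun n =>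
    (series (exp_coeff a) n * series (exp_coeff b) n - series (exp_coeff (a + b)) n)
      * rnorm x +
    rnorm (series (expterm (c + d) x) n - opexp (c + d) x))) => [n|]; last first.
  have := cvgD (cvgM sq0 (cvg_cst (rnorm x))) d3.
  by rewrite mul0r addr0; exact.
rewrite /u series_expterm_comp addrAC addrC (le_trans (ler_rnormD _ _)) // lerD2r.
have -> : series (exp_coeff a) n * series (exp_coeff b) n - series (exp_coeff (a + b)) n =
   \sum_(0 <= i < n) \sum_(0 <= j < n | (n <= i + j)%N) exp_coeff a i * exp_coeff b j.
  rewrite !seriesEnat /= big_distrlr /=.
  rewrite sum_square_triangle addrAC; apply/eqP; rewrite -subr_eq0 addrK subr_eq0.
  by apply/eqP/eq_bigr => k _; exact: exp_coeff_convolution.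
rewrite (le_trans (ler_rnorm_sum _ _ _)) // mulr_suml; apply: ler_sum => i _.
rewrite (le_trans (ler_rnorm_sum _ _ _)) // mulr_suml; apply: ler_sum => j _.
rewrite (le_trans (bd _ _ _)) // -[leRHS]mulrA; apply: ler_wpM2l (bd _ _ _).
by apply: exp_coeff_ge0; rewrite mulr_ge0 ?rnorm_ge0.
Qed.

End Exponential.

(** * Vectors spanned by eigenvectors *)

Section PurePoint.
Context {R : realType} {H : hilbertType R}.
Implicit Types (T : H -> H).

Definition eigvecs T : set H := [set e | line e (T e)].

(** The pure point subspace of a self-adjoint operator. *)
Definition pp_space T : set H := closed_span (eigvecs T).

Lemma pp_space_subspace T : closed_subspace (pp_space T).
Proof. exact: closed_span_subspace. Qed.

Lemma sub_pp_space T : eigvecs T `<=` pp_space T.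
Proof. exact: sub_closed_span. Qed.

(** If [T^2 e = b^2 e] with [b <> 0] then [T e + b e] and [T e - b e] satisfy
    [T v = b v] and [T v = - b v], and their difference is [2 b e]; if [T^2 e = 0]
    then [|T e|^2 = <T^2 e, e> = 0]. *)
Lemma square_eigenvector (T : {linear H -> H}) (S : set H) e :
  selfadjoint T -> closed_subspace S -> eigvecs T `<=` S ->
  line e (T (T e)) -> S e.
Proof.
move=> Ts cS TS [a TTe].
have [a0|a0] := eqVneq a 0.
  apply: TS; exists 0; rewrite scale0r; apply: inner0_eq0.
  by rewrite Ts TTe a0 scale0r inner0r.
pose b := sqrtC a; have b2 : b * b = a by rewrite -expr2 sqrtCK.
have b0 : b != 0 by rewrite sqrtC_eq0.
have Sp : S (T e + b *: e).
  apply: TS; exists b; rewrite linearD linearZ /= TTe -b2 scalerDr scalerA.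
  by rewrite addrC.
have Sm : S (T e - b *: e).
  apply: TS; exists (- b); rewrite linearB linearZ /= TTe -b2 scalerBr scalerA mulNr.
  by rewrite !scaleNr opprK addrC.
have -> : e = (b + b)^-1 *: ((T e + b *: e) - (T e - b *: e)).
  rewrite opprB [T e + _]addrC addrACA subrr addr0 -scalerDl scalerA mulVf ?scale1r //.
  by rewrite -mulr2n mulrn_eq0.
by apply: subspaceZ => //; exact: subspaceB.
Qed.

End PurePoint.

(** * Cosine and sine of an operator *)

Section Trigonometry.
Context {R : realType} {H : hilbertType R}.
Variable Z : {linear H -> H}.
Hypothesis Zb : bounded_op Z.
Implicit Types (x y e : H) (s t : R).

Local Notation U t := (opexp Z ('i%C * t%:C%C)).
Local Notation half := ((2^-1 : R)%:C%C).

Definition opcos t x : H := half *: (U t x + U (- t) x).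
Definition opsin t x : H := 'i%C *: (half *: (U (- t) x - U t x)).

Lemma scale_halfD x : half *: (x + x) = x.
Proof.
rewrite scalerDr -scalerDl -rmorphD /= -[RHS]scale1r; congr (_ *: _).
by rewrite -mulr2n -[_ *+ 2]mulr_natr mulVf ?pnatr_eq0.
Qed.

Lemma scaleii x : 'i%C *: ('i%C *: x) = - x.
Proof. by rewrite scalerA -expr2 sqr_i scaleN1r. Qed.

Lemma opexpi_add s t x : U s (U t x) = U (s + t) x.
Proof. by rewrite opexp_opexp // rmorphD mulrDr. Qed.

(** The linearity of these operators depends on the convergence of the series,
    hence on a bound of [Z]; linear structures are therefore packed by hand. *)
Definition lin_opexp c : {linear H -> H} :=
  HB.pack (opexp Z c) (GRing.isLinear.Build R[i] H H *:%R (opexp Z c) (opexp_linear Zb c)).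

Lemma opexpi0 x : U 0 x = x.
Proof. by rewrite mulr0 opexp0. Qed.

Lemma opexpiK t x : U t (U (- t) x) = x.
Proof. by rewrite opexpi_add subrr opexpi0. Qed.

Lemma opexpiE t x : U t x = opcos t x + 'i%C *: opsin t x.
Proof.
rewrite /opcos /opsin scaleii -scalerN opprB -scalerDr.
by rewrite addrACA subrr addr0 scale_halfD.
Qed.

Lemma opcos_linear t : linear (opcos t).
Proof.
move=> a x y; rewrite /opcos !opexp_linear // !scalerDr !scalerA [a * _]mulrC.
by rewrite addrACA.
Qed.

Lemma opsin_linear t : linear (opsin t).
Proof.
move=> a x y; rewrite /opsin !opexp_linear // opprD !scalerDr !scalerN !scalerA.
by rewrite [a * _]mulrC addrACA.
Qed.

Definition lin_opcos t : {linear H -> H} :=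
  HB.pack (opcos t) (GRing.isLinear.Build R[i] H H *:%R (opcos t) (opcos_linear t)).
Definition lin_opsin t : {linear H -> H} :=
  HB.pack (opsin t) (GRing.isLinear.Build R[i] H H *:%R (opsin t) (opsin_linear t)).

Lemma opcosZ t a x : opcos t (a *: x) = a *: opcos t x.
Proof. exact: (linearZZ (lin_opcos t)). Qed.

Lemma opcosB t x y : opcos t (x - y) = opcos t x - opcos t y.
Proof. exact: (linearB (lin_opcos t)). Qed.

Lemma opsinB t x y : opsin t (x - y) = opsin t x - opsin t y.
Proof. exact: (linearB (lin_opsin t)). Qed.

Lemma opsin_opp t x : opsin t (- x) = - opsin t x.
Proof. exact: (linearN (lin_opsin t)). Qed.

Lemma opcos_bounded t : bounded_op (opcos t).
Proof.
have [M M0 UM] := opexp_bounded Zb ('i%C * t%:C%C).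
have [N N0 UN] := opexp_bounded Zb ('i%C * (- t)%:C%C).
exists (2^-1 * (M + N)) => [|x]; first by rewrite mulr_ge0 ?addr_ge0 ?invr_ge0.
rewrite rnormZ rnorm_real ger0_norm ?invr_ge0 // -mulrA ler_wpM2l ?invr_ge0 //.
by rewrite (le_trans (ler_rnormD _ _)) // mulrDl lerD.
Qed.

Lemma opsin0 t : opsin t 0 = 0.
Proof. exact: (linear0 (lin_opsin t)). Qed.

Lemma opcosN t x : opcos (- t) x = opcos t x.
Proof. by rewrite /opcos opprK addrC. Qed.

Lemma opsinN t x : opsin (- t) x = - opsin t x.
Proof. by rewrite /opsin opprK -opprB !scalerN. Qed.

Lemma opcos_sqr t x : opcos t (opcos t x) = half *: (opcos (t + t) x + x).
Proof.
rewrite /opcos !opexpZ // !opexpD // !opexpi_add addNr subrr !opexpi0 opprD.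
rewrite -!scalerDr; congr (_ *: _).
by rewrite [x + _]addrC addrACA scalerDr scale_halfD.
Qed.

Lemma opsin_sqr t x : opsin t (opsin t x) = half *: (x - opcos (t + t) x).
Proof.
rewrite /opsin /opcos !opexpZ // -!scalerBr scalerA -['i%C * _]mulrC -!scalerA scaleii.
rewrite !opexpB // !opexpi_add addNr subrr !opexpi0 (opprD t t).
set A := U (t + t) x; set B := U (- t - t) x.
rewrite -scalerN; congr (_ *: _).
have -> : - (B - x - (x - A)) = (x + x) - (A + B).
  by rewrite !opprB addrACA opprD.
by rewrite scalerBr scale_halfD.
Qed.

Lemma eigvecs_opexp c : eigvecs Z `<=` eigvecs (opexp Z c).
Proof. by move=> e [a]; exact: opexp_eigen. Qed.

Lemma eigvecs_opcos t : eigvecs Z `<=` eigvecs (opcos t).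
Proof.
move=> e Ze; have ce := line_subspace e.
by apply: (subspaceZ half ce); apply: (subspaceD ce); exact: eigvecs_opexp.
Qed.

Lemma eigvecs_opsin t : eigvecs Z `<=` eigvecs (opsin t).
Proof.
move=> e Ze; have ce := line_subspace e.
apply: (subspaceZ 'i%C ce); apply: (subspaceZ half ce).
by apply: (subspaceB ce); exact: eigvecs_opexp.
Qed.

Lemma conj_imaginary t : ('i%C * t%:C%C)^* = 'i%C * (- t)%:C%C :> R[i].
Proof. by apply/eqP; rewrite eq_complex /=; apply/andP; split; apply/eqP; ring. Qed.

Hypothesis Zs : selfadjoint Z.

Lemma opexpi_adjoint t x y : inner (U t x) y = inner x (U (- t) y).
Proof. by rewrite opexp_adjoint // conj_imaginary. Qed.

Lemma opcos_selfadjoint t : selfadjoint (opcos t).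
Proof.
move=> x y; rewrite /opcos innerZl innerZr.
have -> : half^* = half :> R[i] by exact: conjc_real.
congr (_ * _).
by rewrite innerDl innerDr !opexpi_adjoint opprK addrC.
Qed.

Lemma opexpi_unitary t : unitary (U t).
Proof.
split; first by move=> a x y; exact: opexp_linear.
- by move=> x y; rewrite opexpi_adjoint opexpi_add addNr opexpi0.
- by move=> y _; exists (U (- t) y) => //; exact: opexpiK.
Qed.

(** Taylor estimates of orders 1 and 3; the odd terms cancel in the average of
    the two exponentials. *)
Lemma opcos_taylor : exists2 B : R, 0 < B & forall t x, `|t| <= 1 ->
  rnorm (opcos t x - x) <= `|t| * (B * rnorm x) /\
  rnorm (opcos t x - (x - (t ^+ 2 / 2)%:C%C *: Z (Z x))) <= `|t| ^+ 3 * (B * rnorm x).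
Proof.
have [B B0 tay] := opexp_taylor Zb; exists (B + 1) => [|t x t1]; first by lra.
have rt s : rnorm ('i%C * s%:C%C : R[i]) = `|s|.
  by rewrite rnormM complexiE rnormi mul1r rnorm_real.
have avg n y : y = half *: (series (expterm Z ('i%C * t%:C%C) x) n
                          + series (expterm Z ('i%C * (- t)%:C%C) x) n) ->
    rnorm (opcos t x - y) <= `|t| ^+ n * ((B + 1) * rnorm x).
  move=> ->; rewrite /opcos -scalerBr opprD addrACA rnormZ rnorm_real.
  rewrite ger0_norm //.
  have e1 := tay ('i%C * t%:C%C) x n; rewrite rt in e1.
  have e2 := tay ('i%C * (- t)%:C%C) x n; rewrite rt normrN in e2.
  have e0 : `|t| ^+ n * (B * rnorm x) <= `|t| ^+ n * ((B + 1) * rnorm x).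
    rewrite ler_wpM2l ?exprn_ge0 ?normr_ge0 // mulrDl lerDl mul1r.
    exact: rnorm_ge0.
  rewrite mulrC ler_pdivrMr ?ltr0n // mulr_natr mulr2n.
  apply: le_trans (ler_rnormD _ _) _; apply: lerD.
    exact: le_trans (e1 t1) e0.
  exact: le_trans (e2 t1) e0.
split.
  rewrite -[X in X * _]expr1; apply: avg.
  by rewrite !series_expterm1 scale_halfD.
apply: avg; rewrite !series_expterm3.
have sq s : ('i%C * s%:C%C) ^+ 2 / 2 = - (s ^+ 2 / 2)%:C%C :> R[i].
  by rewrite exprMn sqr_i mulN1r mulNr rmorphM rmorphXn fmorphV rmorph_nat.
rewrite !sq sqrrN rmorphN mulrN !scaleNr.
set p := _ *: Z x; set q := _ *: Z (Z x).
have -> : x + p - q + (x - p - q) = (x - q) + (x - q).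
  by rewrite [x + p - q]addrAC [x - p - q]addrAC addrACA subrr addr0.
by rewrite scale_halfD.
Qed.

End Trigonometry.

(** * From eigenvectors of the cosine to eigenvectors of the operator *)

Section CosineEigenvectors.
Context {R : realType} {H : hilbertType R}.
Variable Z : {linear H -> H}.
Hypothesis Zb : bounded_op Z.
Implicit Types (x y e : H) (s t : R).

Local Notation half := ((2^-1 : R)%:C%C).
Local Notation opcos := (opcos Z).
Local Notation opsin := (opsin Z).

(** As [(1 + b) + (1 - b) = 2], one of the two square roots is at distance at
    least [1] from [-1]. *)
Lemma square_root_far_from_minus1 (a : R[i]) : exists2 b, b * b = a & 1 <= rnorm (1 + b).
Proof.
pose b := sqrtC a; have b2 : b * b = a by rewrite -expr2 sqrtCK.
have [b1|b1] := leP 1 (rnorm (1 + b)); first by exists b.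
exists (- b); first by rewrite mulrNN.
have : 2 <= rnorm (1 + b) + rnorm (1 - b).
  apply: le_trans (ler_rnormD _ _); rewrite addrACA subrr addr0.
  have -> : 1 + 1 = (2 : R)%:C%C :> R[i] by rewrite rmorph_nat.
  by rewrite rnorm_real ger0_norm.
lra.
Qed.

(** Write [K = cos tZ], so that [K^2 e = b^2 e] with [|1 + b| >= 1].  Then
    [y = K e - b e] satisfies [K y = - b y], so [|K y - y| >= |y|], while [K] is
    within [1/2] of the identity; hence [y = 0]. *)
Lemma opcos_halving : exists2 r : R, 0 < r <= 1 & forall t e, `|t| <= r ->
  line e (opcos (t + t) e) -> line e (opcos t e).
Proof.
have [B B0 tay] := opcos_taylor Zb; exists (2 * B + 1)^-1 => [|t e tr].
  by rewrite invr_gt0 invf_le1; lra.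
have t1 : `|t| <= 1 by rewrite (le_trans tr) // invf_le1; lra.
have tB : `|t| * B <= 2^-1.
  rewrite (le_trans (ler_wpM2r (ltW B0) tr)) // mulrC ler_pdivrMr; lra.
have near1 y : rnorm (opcos t y - y) <= 2^-1 * rnorm y.
  rewrite (le_trans (tay t y t1).1) // mulrA ler_wpM2r ?rnorm_ge0 //.
move=> [m cm].
have [b bE b1] := square_root_far_from_minus1 (half * (m + 1)).
exists b; apply/eqP; rewrite -subr_eq0; apply/eqP.
set y := _ - _.
have K2 : opcos t (opcos t e) = (b * b) *: e.
  by rewrite opcos_sqr // cm bE -scalerA scalerDl scale1r.
have Ky : opcos t y = - b *: y.
  rewrite /y opcosB // [opcos t (b *: e)]opcosZ // K2.
  by rewrite -scalerA -scalerBr -opprB scalerN scaleNr.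
have yle : rnorm y <= 2^-1 * rnorm y.
  apply: le_trans (near1 y).
  have -> : opcos t y - y = - (1 + b) *: y.
    by rewrite Ky (opprD 1 b) scalerDl scaleN1r addrC.
  by rewrite rnormZ rnormN ler_peMl ?rnorm_ge0.
apply: rnorm0_eq0; have := rnorm_ge0 y; lra.
Qed.

(** By repeated halving [e] is an eigenvector of [cos sZ] for all [s = t/2^k],
    so the vectors [2 (e - cos(sZ) e) / s^2] lie on the line of [e]; by the Taylor
    estimate of order 3 they converge to [Z^2 e]. *)
Lemma sqr_eigen_of_opcos : exists2 r : R, 0 < r & forall t e, t != 0 -> `|t| <= r ->
  line e (opcos t e) -> line e (Z (Z e)).
Proof.
have [r /andP[r0 r1] halve] := opcos_halving; exists r => // t e t0 tr ct.
pose s k := t / 2 ^+ k.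
have sS k : s k = s k.+1 + s k.+1.
  by rewrite /s exprS; field; rewrite expf_neq0 ?pnatr_eq0.
have s0 k : s k != 0 by rewrite mulf_neq0 // invr_neq0 // expf_neq0 // pnatr_eq0.
have s_le k : `|s k| <= r.
  apply: le_trans tr; rewrite normrM normfV ler_piMr //.
  by rewrite invf_le1 ?normr_gt0 ?expf_neq0 ?pnatr_eq0 // normrX normr_nat exprn_ege1 // ler1n.
have cs k : line e (opcos (s k) e).
  elim: k => [|k IHk]; first by rewrite /s expr0 divr1.
  by apply: halve => //; rewrite -sS.
have [B B0 tay] := opcos_taylor Zb.
pose v k := (2 / s k ^+ 2)%:C%C *: (e - opcos (s k) e).
apply: (@subspace_lim _ _ _ v _ (line_subspace e)) => [k|].
  apply: (subspaceZ _ (line_subspace e)); apply: (subspaceB (line_subspace e)) => //.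
  by exists 1; rewrite scale1r.
apply: (@cvg_dominated _ _ _ _ (fun k => 2 * `|t| * B * rnorm e * 2^-1 ^+ k)) => [k|]; last first.
  have := cvgM (cvg_cst (2 * `|t| * B * rnorm e)) (@cvg_expr _ (2^-1 : R) _).
  by rewrite mulr0; apply; rewrite ger0_norm ?invr_ge0 // invf_lt1 // ltr1n.
have := (tay (s k) e (le_trans (s_le k) r1)).2.
set w := opcos _ _ - _ => wle.
have -> : v k - Z (Z e) = - (2 / s k ^+ 2)%:C%C *: w.
  have ss : (2 / s k ^+ 2)%:C%C * (s k ^+ 2 / 2)%:C%C = 1 :> R[i].
    rewrite -rmorphM /= (_ : _ / _ * _ = 1) //.
    by field; rewrite s0.
  rewrite /v /w scaleNr -scalerN opprB [in RHS]addrAC [in RHS]scalerBr scalerA ss.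
  by rewrite scale1r.
rewrite rnormZ rnormN rnorm_real.
apply: (le_trans (ler_wpM2l _ wle)) => //.
rewrite normrM normfV normrX normr_nat.
have -> : 2 / `|s k| ^+ 2 * (`|s k| ^+ 3 * (B * rnorm e)) = 2 * `|s k| * B * rnorm e.
  by field; rewrite normr_eq0 s0.
rewrite /s normrM normfV normrX normr_nat exprVn le_eqVlt; apply/orP; left.
by apply/eqP; ring.
Qed.

Hypothesis Zs : selfadjoint Z.

(** Small times are covered by [sqr_eigen_of_opcos], since an eigenvector of
    [Z^2] is a sum of eigenvectors of [Z]; the duplication formula and the same
    fact for [cos tZ] double the range of times at each step. *)
Lemma opcos_eigvecs_pp t e : t != 0 -> line e (opcos t e) -> pp_space Z e.
Proof.
have [r r0 small] := sqr_eigen_of_opcos.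
suff main k s e' : s != 0 -> `|s| <= r * 2 ^+ k -> line e' (opcos s e') -> pp_space Z e'.
  move=> t0; pose k := Num.bound (`|t| / r).
  apply: (main k) => //; rewrite mulrC -ler_pdivrMr // ltW //.
  apply: (@lt_trans _ _ k%:R); first by rewrite archi_boundP // divr_ge0 // ltW.
  by rewrite -natrX ltr_nat ltn_expl.
elim: k s e' => [|k IHk] s e' s0 sr cs.
  apply: (square_eigenvector Zs (pp_space_subspace Z) (@sub_pp_space _ _ Z)).
  by apply: (small s) => //; rewrite expr0 mulr1 in sr.
have hs0 : s / 2 != 0 by rewrite mulf_neq0 // invr_neq0 // pnatr_eq0.
apply: (@square_eigenvector _ _ (lin_opcos Zb (s / 2))) => /=.
- exact: opcos_selfadjoint.
- exact: pp_space_subspace.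
- move=> x; apply: IHk => //.
  by rewrite normrM normfV normr_nat ler_pdivrMr // -mulrA -exprSr.
- rewrite opcos_sqr // -splitr.
  have ce := line_subspace e'; apply: (subspaceZ _ ce); apply: (subspaceD ce) => //.
  by exists 1; rewrite scale1r.
Qed.

Lemma opcos_ker_pp t x : t != 0 -> opcos t x = 0 -> pp_space Z x.
Proof. by move=> t0 cx; apply: (opcos_eigvecs_pp t0); exists 0; rewrite cx scale0r. Qed.

(** [sin(tZ) x = 0] gives [cos(2tZ) x = x], by the duplication formula. *)
Lemma opsin_ker_pp t x : t != 0 -> opsin t x = 0 -> pp_space Z x.
Proof.
move=> t0 sx; have tt0 : t + t != 0 by rewrite -mulr2n mulrn_eq0.
apply: (opcos_eigvecs_pp tt0); exists 1; rewrite scale1r.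
have : opsin t (opsin t x) = 0 by rewrite sx opsin0.
rewrite opsin_sqr // => /(congr1 (fun y => y + y)).
rewrite -scalerDr scale_halfD addr0 => /eqP.
by rewrite subr_eq0 => /eqP <-.
Qed.

End CosineEigenvectors.

(** * Reducing subspaces and orthonormal eigenbases *)

Section Projections.
Context {R : realType} {H : hilbertType R}.
Implicit Types (x y e : H) (S A B : set H).

Lemma orthproj_linear S : closed_subspace S -> linear (orthproj S).
Proof.
move=> cS a x y; have [Px ox] := orthoprojP x cS; have [Py oy] := orthoprojP y cS.
apply: orthproj_unique => //; first exact: subspaceP.
rewrite opprD addrACA -scalerBr.
exact: (subspaceP _ (orthocompl_subspace S)).
Qed.

Definition lin_orthproj S (cS : closed_subspace S) : {linear H -> H} :=
  HB.pack (orthproj S)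
    (GRing.isLinear.Build R[i] H H *:%R (orthproj S) (orthproj_linear cS)).

Lemma orthprojZ S a x : closed_subspace S -> orthproj S (a *: x) = a *: orthproj S x.
Proof. by move=> cS; exact: (linearZZ (lin_orthproj cS)). Qed.

Lemma orthproj_bounded S : closed_subspace S -> bounded_op (orthproj S).
Proof.
move=> cS; exists 1 => // x; rewrite mul1r; have [Px ox] := orthoprojP x cS.
have := pythagoras (ox _ Px); rewrite subrK => xE.
rewrite -(@ler_pXn2r _ 2) ?nnegrE ?rnorm_ge0 // xE.
by rewrite lerDr exprn_ge0 ?rnorm_ge0.
Qed.

Lemma orthproj_id S x : closed_subspace S -> S x -> orthproj S x = x.
Proof.
move=> cS Sx; apply: orthproj_unique => //; rewrite subrr.
exact: subspace0 (orthocompl_subspace S).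
Qed.

Lemma orthproj_compl S x : closed_subspace S -> orthocompl S x -> orthproj S x = 0.
Proof.
by move=> cS ox; apply: orthproj_unique => //; [exact: subspace0|rewrite subr0].
Qed.

Lemma preimage_subspace (T : {linear H -> H}) S : bounded_op T -> closed_subspace S ->
  closed_subspace [set x | S (T x)].
Proof.
move=> Tb cS; apply: closed_subspaceI => /=.
- by rewrite linear0; exact: subspace0.
- by move=> a x y Sx Sy; rewrite linearP; exact: subspaceP.
- by move=> u l Su ul; apply: subspace_lim (bounded_op_cvg Tb ul).
Qed.

Lemma setI_subspace S A : closed_subspace S -> closed_subspace A ->
  closed_subspace (S `&` A).
Proof.
move=> cS cA; apply: closed_subspaceI.
- by split; exact: subspace0.
- by move=> a x y [? ?] [? ?]; split; exact: subspaceP.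
- by move=> u l Su ul; split; apply: subspace_lim ul => // n; case: (Su n).
Qed.

Lemma orthocompl_invariant (T : H -> H) S : selfadjoint T ->
  (forall x, S x -> S (T x)) -> forall x, orthocompl S x -> orthocompl S (T x).
Proof. by move=> Ts TS x ox y Sy; rewrite Ts; apply/ox/TS. Qed.

(** The complement of an invariant subspace of a self-adjoint operator is
    invariant too, so the operator respects the decomposition [x = P x + (x - P x)]. *)
Lemma orthproj_reducing (T : {linear H -> H}) S x : closed_subspace S ->
  selfadjoint T -> (forall x, S x -> S (T x)) ->
  orthproj S (T x) = T (orthproj S x).
Proof.
move=> cS Ts TS; have [Px ox] := orthoprojP x cS.
apply: orthproj_unique => //; first exact: TS.
by rewrite -linearB; apply: (orthocompl_invariant Ts TS).
Qed.

Lemma eigvecs_orthproj (T : {linear H -> H}) S e : closed_subspace S ->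
  selfadjoint T -> (forall x, S x -> S (T x)) ->
  line e (T e) -> line (orthproj S e) (T (orthproj S e)).
Proof.
move=> cS Ts TS [a Te]; exists a.
by rewrite -orthproj_reducing // Te orthprojZ.
Qed.

Lemma orthocompl_eigvecs0 (T : H -> H) x : pp_space T = setT ->
  (forall e, line e (T e) -> inner x e = 0) -> x = 0.
Proof.
move=> ppT ox; apply: (@orthocompl_disjoint _ _ (pp_space T)); first by rewrite ppT.
by rewrite orthocompl_closed_span.
Qed.

Lemma pp_space_total (T : H -> H) :
  (forall x, orthocompl (pp_space T) x -> x = 0) -> pp_space T = setT.
Proof.
move=> pp0; rewrite -(orthocomplK (pp_space_subspace T)); apply/seteqP; split=> // x _ y /pp0 ->.
exact: inner0r.
Qed.

Lemma orthonormal_neq0 B b : orthonormal_set B -> B b -> b != 0.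
Proof.
move=> oB Bb; apply/eqP => b0; have := oB _ _ Bb Bb.
by rewrite eqxx b0 inner0l => /esym/eqP; rewrite oner_eq0.
Qed.

(** Take, by Zorn's lemma, a maximal orthonormal set [B] of eigenvectors in [S].
    The vectors of [S] orthogonal to [B] form a closed invariant subspace [N]; the
    projection on [N] of any eigenvector is an eigenvector, and must vanish by
    maximality.  So all eigenvectors are orthogonal to [N], and [N = 0]. *)
Lemma orthonormal_eigenbasis (T : {linear H -> H}) S :
  selfadjoint T -> pp_space T = setT -> closed_subspace S ->
  (forall x, S x -> S (T x)) ->
  exists2 B, orthonormal_basis S B & B `<=` eigvecs T.
Proof.
move=> Ts ppT cS TS.
pose P B := [/\ orthonormal_set B, B `<=` S & B `<=` eigvecs T].
have [B [[oB BS BT] maxB]] : exists B, P B /\ forall C, B `<` C -> ~ P C.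
  apply: Zorn_bigcup => F FP tot; split.
  - move=> x y [X FX Xx] [Y FY Yy]; have [XY|YX] := tot _ _ FX FY.
      by have [oY _ _] := FP _ FY; apply: oY => //; exact: XY.
    by have [oX _ _] := FP _ FX; apply: oX => //; exact: YX.
  - by move=> x [X FX Xx]; have [_ XS _] := FP _ FX; exact: XS.
  - by move=> x [X FX Xx]; have [_ _ XT] := FP _ FX; exact: XT.
exists B => //; split=> //.
pose N := S `&` orthocompl B.
have cN : closed_subspace N by apply: setI_subspace => //; exact: orthocompl_subspace.
have TN x : N x -> N (T x).
  move=> [Sx ox]; split; first exact: TS.
  move=> b Bb; have [a Tb] := BT _ Bb.
  by rewrite Ts Tb innerZr ox // mulr0.
have N0 x : N x -> x = 0.
  move=> Nx; apply: (orthocompl_eigvecs0 ppT) => e eT.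
  have [Ne oe] := orthoprojP e cN.
  have eN := eigvecs_orthproj cN Ts TN eT.
  suff e0 : orthproj N e = 0.
    by apply: inner_eq0C; have := oe _ Nx; rewrite e0 subr0.
  apply/eqP/negP => /negP p0; move: Ne eN p0; move: (orthproj N e) => p [Sp op] [a Tp] p0.
  have rp0 : rnorm p != 0 by apply: contra_neq p0; exact: rnorm0_eq0.
  (* Adding the normalized [p] to [B] contradicts maximality. *)
  pose u := ((rnorm p)^-1)%:C%C *: p.
  have uu : inner u u = 1.
    rewrite inner_rnorm rnormZ rnorm_real ger0_norm ?invr_ge0 ?rnorm_ge0 //.
    by rewrite mulVf // expr1n.
  have ou b : B b -> inner u b = 0 by move=> Bb; rewrite innerZl op // mulr0.
  have uB : ~ B u by move=> /ou; rewrite uu => /eqP; rewrite oner_eq0.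
  apply: (maxB (B `|` [set u])).
    rewrite properEneq; split; last by move=> b; left.
    by apply/eqP => BE; apply: uB; rewrite BE; right.
  split.
  - move=> x1 x2 [B1|->] [B2|->].
    + exact: oB.
    + rewrite inner_eq0C ?ou //; case: eqP => // x1u.
      by case: uB; rewrite -x1u.
    + rewrite ou //; case: eqP => // ux2.
      by case: uB; rewrite ux2.
    + by rewrite uu eqxx.
  - by move=> b [/BS //|->]; exact: subspaceZ.
  - move=> b [/BT //|->]; exists a.
    by rewrite /u linearZ /= Tp !scalerA mulrC.
apply/seteqP; split; first exact: closed_span_min.
move=> x Sx; have cB := closed_span_subspace B.
have [Bp op] := orthoprojP x cB.
have /eqP : x - orthproj (closed_span B) x = 0.
  apply: N0; split; last by rewrite orthocompl_closed_span in op.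
  by apply: subspaceB => //; exact: closed_span_min Bp.
by rewrite subr_eq0 => /eqP ->.
Qed.

(** Distinct vectors of the set are at distance [sqrt 2], so they cannot be
    within [1/2] of the same point of a countable dense set. *)
Lemma orthonormal_countable B : separable_space H -> orthonormal_set B -> countable B.
Proof.
move=> [A /countable_injP[f finj] dA] oB.
have e0 : 0 < (2^-1 : R)%:C%C by rewrite ltcR invr_gt0.
have near b : exists a, A a /\ rnorm (b - a) < 2^-1.
  have [a [ba Aa]] := dA (ball b (2^-1 : R)%:C%C) (ex_intro _ b (ballxx _ e0)) (ball_open _ _).
  by exists a; split=> //; move: ba; rewrite -ball_normE /= rnormE ltcR.
have [g gP] := choice near.
apply/countable_injP; exists (f \o g) => b c; rewrite !inE => Bb Bc /= fg.
have gbc : g b = g c.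
  by apply: finj; rewrite ?inE //; [case: (gP b)|case: (gP c)].
apply/eqP/negPn/negP => bc.
have : rnorm (b - c) < 1.
  have -> : b - c = (b - g b) - (c - g c) by rewrite gbc opprB addrA subrK.
  apply: (le_lt_trans (ler_rnormB _ _)).
  have [[_ lb] [_ lc]] := (gP b, gP c); lra.
have : rnorm (b - c) ^+ 2 = 2.
  apply: (@complexI R); rewrite -inner_rnorm !innerBl !innerBr !oB //.
  by rewrite !eqxx [c == b]eq_sym (negbTE bc) rmorph_nat subr0 sub0r opprK.
have := rnorm_ge0 (b - c); nra.
Qed.

End Projections.

(** * Schmidt decompositions of self-adjoint operators *)

Lemma sum_delta (V : nmodType) (D : set nat) (F : nat -> V) n j : D j ->
  \sum_(0 <= k < n | k \in D) (if k == j then F k else 0) = if (j < n)%N then F j else 0.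
Proof.
move=> Dj; rewrite -big_mkcondr /=.
transitivity (\sum_(0 <= k < n | k == j) F k); last by rewrite big_nat1_eq.
by apply: eq_bigl => k; case: eqP => [->|]; rewrite ?andbT ?andbF // mem_set.
Qed.

Section Expansion.
Context {R : realType} {H : hilbertType R}.
Variables (D : set nat) (e : nat -> H).
Hypothesis e_on : forall m n, D m -> D n -> inner (e m) (e n) = (m == n)%:R.

Definition expansion n h : H := \sum_(0 <= k < n | k \in D) inner h (e k) *: e k.

Lemma expansion_linear n : linear (expansion n).
Proof.
move=> a x y; rewrite /expansion scaler_sumr -big_split /=.
by apply: eq_bigr => k _; rewrite innerPl scalerDl scalerA.
Qed.

Lemma inner_expansion n j h : D j ->
  inner (expansion n h) (e j) = if (j < n)%N then inner h (e j) else 0.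
Proof.
move=> Dj; rewrite inner_suml -(sum_delta (fun k => inner h (e k)) n Dj).
apply: eq_bigr => k /set_mem Dk.
by rewrite innerZl e_on //; case: eqP; rewrite ?mulr1 ?mulr0.
Qed.

Lemma expansion_le n h : rnorm (expansion n h) <= rnorm h.
Proof.
have orth : inner (h - expansion n h) (expansion n h) = 0.
  rewrite {2}/expansion inner_sumr big_nat_cond big1 // => k /andP[/andP[_ kn] /set_mem Dk].
  by rewrite innerZr innerBl inner_expansion // kn subrr mulr0.
have := pythagoras orth; rewrite subrK => hE.
by rewrite -(@ler_pXn2r _ 2) ?nnegrE ?rnorm_ge0 // hE lerDr exprn_ge0 ?rnorm_ge0.
Qed.

(** The vectors that are the sum of their expansion form a subspace which is
    closed because the partial sums are contractions, by Bessel's inequality. *)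
Lemma expansion_cvg h : closed_span (e @` D) h -> expansion n h @[n --> \oo] --> h.
Proof.
apply: (closed_span_min (M := [set h | expansion n h @[n --> \oo] --> h])).
  apply: closed_subspaceI => /=.
  - apply/cvg_rnormP; apply: cvg_near_cst; apply: nearW => n.
    rewrite subr0 /expansion big1 ?rnorm0 // => k _.
    by rewrite inner0l scale0r.
  - move=> a x y xc yc.
    have -> : (fun n => expansion n (a *: x + y)) =
              (fun n => a *: expansion n x + expansion n y).
      by apply/funext => n; exact: expansion_linear.
    exact: cvg_comb.
  - move=> u l uc /cvg_rnormP ul; apply/cvg_rnormP/cvgrPdist_lt => eps eps0.
    have eps3 : 0 < eps / 3 by rewrite divr_gt0.
    have [m _ mP] := (cvgrPdist_lt _ _).1 ul _ eps3.
    have ulm : rnorm (u m - l) < eps / 3.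
      by have := mP m (leqnn m); rewrite sub0r normrN ger0_norm ?rnorm_ge0.
    have /cvg_rnormP um := uc m.
    apply: filterS ((cvgrPdist_lt _ _).1 um _ eps3) => n.
    rewrite !sub0r !normrN !ger0_norm ?rnorm_ge0 // => unm.
    have -> : expansion n l - l =
        (expansion n (u m) - u m) + (u m - l) - expansion n (u m - l).
      have -> : expansion n (u m - l) = expansion n (u m) - expansion n l.
        by rewrite addrC -scaleN1r expansion_linear scaleN1r addrC.
      by rewrite addrA subrK opprB [RHS]addrC addrA subrK.
    apply: (le_lt_trans (ler_rnormB _ _)).
    have := ler_rnormD (expansion n (u m) - u m) (u m - l).
    have := expansion_le n (u m - l).
    move: unm ulm; lra.
move=> _ [j Dj <-] /=.
apply/cvg_rnormP; apply: cvg_near_cst; exists j.+1 => // n /= jn.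
rewrite /expansion (_ : \sum_(_ <= _ < _ | _) _ = e j) ?subrr ?rnorm0 //.
transitivity (if (j < n)%N then e j else 0); last by rewrite jn.
rewrite -(sum_delta e n Dj); apply: eq_bigr => k /set_mem Dk.
by rewrite e_on // eq_sym; case: eqP => _; rewrite ?scale1r ?scale0r.
Qed.

End Expansion.

Section Schmidt.
Context {R : realType} {H : hilbertType R}.

Lemma selfadjoint_eigenvalue (C : {linear H -> H}) b : selfadjoint C -> inner b b = 1 ->
  line b (C b) -> C b = (complex.Re (inner (C b) b))%:C%C *: b.
Proof.
move=> Cs bb [a Cb]; rewrite Cb innerZl bb mulr1; congr (_ *: _).
have : a = a^*.
  have := Cs b b; rewrite Cb innerZl innerZr bb !mulr1; exact.
case: {Cb} a => x y /eqP; rewrite eq_complex /= => /andP[_ /eqP yE].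
congr (Complex _ _); lra.
Qed.

(** If [C e_n = c_n e_n] then [C = sum |c_n| (sgn(c_n) e_n) (x) e_n], the sum
    running over the nonzero [c_n].  An injection of the basis into the integers
    provides the indexing. *)
Lemma schmidt_of_eigenbasis (C : {linear H -> H}) (T : H -> H) L B :
  bounded_op C -> selfadjoint C -> orthonormal_basis L B -> countable B ->
  B `<=` eigvecs C -> (forall h, L h -> T h = C h) -> schmidt_decomposable L T.
Proof.
move=> Cb Cs [oB BL] /countable_injP[f finj] BC TC.
pose e n : H := xget 0 [set b | B b /\ f b = n].
pose D := f @` B.
have eB n : D n -> B (e n) /\ f (e n) = n.
  by move=> [b Bb fb]; apply: (@xgetPex _ 0 [set b | B b /\ f b = n]); exists b.
have ef b : B b -> e (f b) = b.
  move=> Bb; have [Be fe] := eB (f b) (ex_intro2 _ _ b Bb erefl).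
  by apply: finj => //; rewrite inE.
have e_on m n : D m -> D n -> inner (e m) (e n) = (m == n)%:R.
  move=> Dm Dn; have [Bm fm] := eB _ Dm; have [Bn fn] := eB _ Dn.
  rewrite oB //; congr ((_ : bool)%:R); apply/eqP/eqP => [emn|-> //].
  by rewrite -fm -fn emn.
have eD : e @` D = B.
  apply/seteqP; split=> [_ [n Dn <-]|b Bb]; first by case: (eB _ Dn).
  by exists (f b); [exists b|exact: ef].
pose c n : R := complex.Re (inner (C (e n)) (e n)).
have Ce n : D n -> C (e n) = (c n)%:C%C *: e n.
  move=> Dn; apply: selfadjoint_eigenvalue => //; first by rewrite e_on ?eqxx.
  by apply: BC; case: (eB _ Dn).
have Le n : D n -> L (e n) by move=> Dn; rewrite -BL; apply: sub_closed_span; case: (eB _ Dn).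
have cL : closed_subspace L by rewrite -BL; exact: closed_span_subspace.
exists [set n | D n /\ c n != 0], (fun n => (Num.sg (c n))%:C%C *: e n), e, (fun n => `|c n|).
split.
- split=> [n [Dn _]|m n [Dm cm] [Dn cn]]; first by apply: subspaceZ => //; exact: Le.
  rewrite innerZl innerZr e_on //; case: eqP => [->|]; last by rewrite !mulr0.
  rewrite mulr1 (_ : _^* = (Num.sg (c n))%:C%C); last exact: conjc_real.
  by rewrite -rmorphM /= -expr2 sqr_sg cn.
- by split=> [n [Dn _]|m n [Dm _] [Dn _]]; [exact: Le|exact: e_on].
- by move=> n [_ cn]; rewrite normr_gt0.
move=> h Lh; rewrite TC //.
have Lc : closed_span (e @` D) h by rewrite eD BL.
have := bounded_op_cvg Cb (expansion_cvg e_on Lc).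
suff -> : (fun n => C (expansion D e n h)) = (fun n =>
   \sum_(0 <= k < n | k \in [set n | D n /\ c n != 0])
      (`|c k|)%:C%C *: rank_one ((Num.sg (c k))%:C%C *: e k) (e k) h) by [].
apply/funext => n; rewrite /expansion linear_sum /= big_mkcond [RHS]big_mkcond /=.
apply: eq_bigr => k _; case: (asboolP (D k)) => Dk; last first.
  rewrite !ifF //; first by apply/negP => /set_mem[].
  by apply/negP => /set_mem.
rewrite ifT; last by rewrite mem_set.
rewrite linearZ /= Ce //.
have [ck|ck] := eqVneq (c k) 0.
  rewrite ifF ?ck ?scale0r ?scaler0 //.
  by apply/negP => /set_mem[_]; rewrite ck eqxx.
rewrite ifT; last by rewrite mem_set.
rewrite /rank_one !scalerA; congr (_ *: _).
rewrite {1}[c k]numEsg rmorphM /=; ring.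
Qed.

(** Testing the expansion on [g_j] and on the [f_j]-component gives
    [C g_j = s_j f_j] and, [C] being self-adjoint, [C f_j = s_j g_j].  So [g_j + f_j]
    and [g_j - f_j] are eigenvectors; a vector orthogonal to them is orthogonal to
    all [g_j], and all terms of its expansion vanish. *)
Lemma schmidt_eigenvectors (C : {linear H -> H}) (T : H -> H) L x :
  selfadjoint C -> closed_subspace L -> (forall h, L h -> L (C h)) ->
  (forall h, L h -> T h = C h) -> schmidt_decomposable L T ->
  L x -> (forall e, L e -> line e (C e) -> inner x e = 0) -> C x = 0.
Proof.
move=> Cs cL CL TC [D [f [g [s [[Lf fo] [Lg go] s0 sc]]]]] Lx xo.
have fix_sum n j : D j -> (j < n)%N ->
   \sum_(0 <= k < n | k \in D) (s k)%:C%C *: rank_one (f k) (g k) (g j) = (s j)%:C%C *: f j.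
  move=> Dj jn; transitivity (if (j < n)%N then (s j)%:C%C *: f j else 0); last by rewrite jn.
  rewrite -(sum_delta (fun k => (s k)%:C%C *: f k) n Dj).
  apply: eq_bigr => k /set_mem Dk.
  rewrite /rank_one go // eq_sym; case: eqP => _; first by rewrite scale1r.
  by rewrite scale0r scaler0.
have Cg j : D j -> C (g j) = (s j)%:C%C *: f j.
  move=> Dj; rewrite -TC; last exact: Lg.
  apply: (cvg_seq_unique (sc _ (Lg _ Dj))); apply/cvg_rnormP.
  apply: cvg_near_cst; exists j.+1 => // n /= jn.
  by rewrite fix_sum // subrr rnorm0.
have Cf j : D j -> C (f j) = (s j)%:C%C *: g j.
  move=> Dj; apply/eqP; rewrite -subr_eq0; apply/eqP.
  set w := _ - _.
  have Lw : L w by apply: subspaceB => //; [exact/CL/Lf|apply: subspaceZ => //; exact: Lg].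
  (* The partial sums are shifted by [j + 1] so that the [j]-th term is always there. *)
  have wE : inner (T w) (f j) = inner w ((s j)%:C%C *: g j).
    have scw := sc _ Lw; rewrite -(cvg_shiftn j.+1) in scw.
    apply: (inner_lim_eq scw (cvg_cst _)) => n.
    rewrite inner_suml innerZr (_ : _^* = (s j)%:C%C); last exact: conjc_real.
    transitivity (if (j < n + j.+1)%N then (s j)%:C%C * inner w (g j) else 0); last first.
      by rewrite ltn_addl.
    rewrite -(sum_delta (fun k => (s k)%:C%C * inner w (g k)) _ Dj).
    apply: eq_bigr => k /set_mem Dk; rewrite !innerZl fo //.
    by case: eqP => _; rewrite ?mulr1 ?mulr0.
  by apply: inner0_eq0; rewrite {2}/w innerBr -Cs -TC // wE subrr.
have cg j : D j -> inner x (g j) = 0.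
  move=> Dj; have [Lfj Lgj] := (Lf _ Dj, Lg _ Dj).
  have p : inner x (g j + f j) = 0.
    apply: xo; first exact: subspaceD.
    by exists (s j)%:C%C; rewrite linearD /= Cg // Cf // -scalerDr addrC.
  have m : inner x (g j - f j) = 0.
    apply: xo; first exact: subspaceB.
    by exists (- (s j)%:C%C); rewrite linearB /= Cg // Cf // -scalerBr scaleNr -scalerN opprB.
  have : inner x (g j) + inner x (g j) = 0.
    by rewrite -[RHS]addr0 -{1}p -m innerDr innerBr addrACA subrr addr0.
  by move/eqP; rewrite -mulr2n mulrn_eq0 /= => /eqP.
rewrite -TC //; apply: (cvg_seq_unique (sc _ Lx)); apply/cvg_rnormP.
apply: cvg_near_cst; apply: nearW => n; rewrite big1 ?subr0 ?rnorm0 // => k /set_mem Dk.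
by rewrite /rank_one cg // scale0r scaler0.
Qed.

End Schmidt.

(** * Co-diagonal operators and geodesics *)

Section Codiagonal.
Context {R : realType} {H : hilbertType R}.
Variables (L : set H) (Z : {linear H -> H}).
Hypothesis cL : closed_subspace L.
Hypothesis Zb : bounded_op Z.
Hypothesis Zs : selfadjoint Z.
Hypothesis Zcd : codiagonal L Z.
Implicit Types (x y e : H) (t : R).

Local Notation Lc := (orthocompl L).
Local Notation P := (orthproj L).
Local Notation U t := (opexp Z ('i%C * t%:C%C)).
Local Notation opcos := (opcos Z).
Local Notation opsin := (opsin Z).
Let cLc : closed_subspace Lc := orthocompl_subspace L.

Lemma codiagonal_sub x : L x -> Lc (Z x).
Proof.
move=> Lx; have := Zcd.1 x; rewrite (orthproj_id cL Lx) => PZ.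
by have := (orthoprojP (Z x) cL).2; rewrite PZ subr0.
Qed.

Lemma codiagonal_compl x : Lc x -> L (Z x).
Proof.
move=> Lx; have := Zcd.2 x; rewrite (orthproj_compl cL Lx) subr0 => /eqP.
by rewrite subr_eq0 => /eqP ->; case: (orthoprojP (Z x) cL).
Qed.

Let Pl : {linear H -> H} := lin_orthproj cL.

(** The orthogonal symmetry across [L], which turns co-diagonality into the
    anticommutation [J Z = - Z J]. *)
Definition reflection : {linear H -> H} := (Pl \+ Pl) \- idfun.

Local Notation J := reflection.

Lemma reflectionE x : J x = P x + P x - x.
Proof. by []. Qed.

Lemma reflection_id x : L x -> J x = x.
Proof. by move=> Lx; rewrite reflectionE orthproj_id // addrK. Qed.

Lemma reflection_opp x : Lc x -> J x = - x.
Proof. by move=> Lx; rewrite reflectionE orthproj_compl // !add0r. Qed.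

Lemma reflection_idP x : J x = x -> L x.
Proof.
rewrite reflectionE => /(canRL (subrK _)) PxE.
have <- : P x = x by rewrite -(scale_halfD (P x)) PxE scale_halfD.
by case: (orthoprojP x cL).
Qed.

Lemma reflection_oppP x : J x = - x -> Lc x.
Proof.
rewrite reflectionE => /(canRL (subrK _)); rewrite addNr => PxE.
have P0 : P x = 0 by rewrite -(scale_halfD (P x)) PxE scaler0.
by have := (orthoprojP x cL).2; rewrite P0 subr0.
Qed.

Lemma reflection_bounded : bounded_op J.
Proof.
have [M M0 PM] := orthproj_bounded cL; exists (M + M + 1) => [|x].
  by rewrite !addr_ge0.
rewrite reflectionE (le_trans (ler_rnormB _ _)) // !mulrDl mul1r lerD2r.
by rewrite (le_trans (ler_rnormD _ _)) // lerD.
Qed.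

Lemma reflection_anticomm x : J (Z x) = - Z (J x).
Proof.
have [Px ox] := orthoprojP x cL; set p := P x in Px ox; set q := x - p in ox.
have JD := linearD J; have ZD := linearD Z.
have -> : x = p + q by rewrite addrC subrK.
move: Px ox; move: @q; move: p => p q; move: q => q Pp Qq.
rewrite ZD !JD ZD (reflection_opp (codiagonal_sub Pp)) (reflection_id (codiagonal_compl Qq)).
by rewrite (reflection_id Pp) (reflection_opp Qq) linearN opprD opprK.
Qed.

Lemma reflection_opexpi t x : J (U t x) = U (- t) (J x).
Proof.
rewrite (opexp_intertwine Zb (s := -1)) ?mulN1r ?rmorphN ?mulrN //.
  exact: reflection_bounded.
by move=> y; rewrite scaleN1r reflection_anticomm.
Qed.

Lemma reflection_opcos t x : J (opcos t x) = opcos t (J x).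
Proof.
by rewrite /opcos (linearZZ J) (linearD J) !reflection_opexpi opprK addrC.
Qed.

Lemma reflection_opsin t x : J (opsin t x) = - opsin t (J x).
Proof.
rewrite /opsin !(linearZZ J) (linearB J) !reflection_opexpi opprK.
by rewrite -!scalerN opprB.
Qed.

Lemma opcos_sub t x : L x -> L (opcos t x).
Proof. by move=> Lx; apply: reflection_idP; rewrite reflection_opcos reflection_id. Qed.

Lemma opsin_sub t x : L x -> Lc (opsin t x).
Proof. by move=> Lx; apply: reflection_oppP; rewrite reflection_opsin reflection_id. Qed.

Lemma opcos_compl t x : Lc x -> Lc (opcos t x).
Proof. exact: (orthocompl_invariant (opcos_selfadjoint Zb Zs t) (@opcos_sub t)). Qed.

Lemma opsin_compl t x : Lc x -> L (opsin t x).
Proof.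
move=> Lx; apply: reflection_idP; rewrite reflection_opsin reflection_opp //.
by rewrite opsin_opp // opprK.
Qed.

Lemma opexpiNE t x : U (- t) x = opcos t x - 'i%C *: opsin t x.
Proof. by rewrite opexpiE // opcosN opsinN scalerN. Qed.

Lemma orthproj_opcos t x : P (opcos t x) = opcos t (P x).
Proof.
exact: (orthproj_reducing (T := lin_opcos Zb t) x cL
  (opcos_selfadjoint Zb Zs t) (@opcos_sub t)).
Qed.

Lemma orthproj_opsin t x : P (opsin t x) = opsin t (x - P x).
Proof.
have [Px ox] := orthoprojP x cL.
apply: orthproj_unique => //; first exact: opsin_compl.
have -> : opsin t x - opsin t (x - P x) = opsin t (P x).
  by rewrite -opsinB // subKr.
exact: opsin_sub.
Qed.

Lemma orthproj_opexpi t x : L x -> P (U t x) = opcos t x.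
Proof.
move=> Lx; apply: orthproj_unique => //; first exact: opcos_sub.
rewrite opexpiE // [_ + _ - _]addrAC subrr add0r.
by apply: (subspaceZ 'i%C cLc); exact: opsin_sub.
Qed.

Lemma geodesicE t : geodesic L Z t = [set x | L (U (- t) x)].
Proof.
rewrite /geodesic expi_opexp; apply/seteqP; split=> [_ [y Ly <-] /=|x Lx].
  by rewrite -complexiE opexpi_add // addNr opexpi0.
by exists (U (- t) x) => //; rewrite -complexiE opexpiK.
Qed.

Lemma geodesic_subspace t : closed_subspace (geodesic L Z t).
Proof.
rewrite geodesicE.
exact: (preimage_subspace (T := lin_opexp Zb _) (opexp_bounded Zb _) cL).
Qed.

Lemma orthocompl_geodesicE t : orthocompl (geodesic L Z t) = [set x | Lc (U (- t) x)].
Proof.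
rewrite geodesicE; apply/seteqP; split=> x xo y Ly.
  rewrite opexpi_adjoint // opprK; apply: xo.
  by rewrite /= opexpi_add // addNr opexpi0.
rewrite -[y](opexpiK Zb t) -[X in inner _ (U X _)](opprK t) -opexpi_adjoint //.
exact: xo.
Qed.

Lemma orthproj_geodesic t x : orthproj (geodesic L Z t) x = U t (P (U (- t) x)).
Proof.
have [Px ox] := orthoprojP (U (- t) x) cL.
apply: orthproj_unique; first exact: geodesic_subspace.
  by rewrite geodesicE /= opexpi_add // addNr opexpi0.
by rewrite orthocompl_geodesicE /= opexpB // opexpi_add // addNr opexpi0.
Qed.

(** On an eigenvector [e] write [e = p + q] with [p] in [L] and [q] in its
    complement.  Both are multiplied by the same scalar [c] under [cos tZ], and
    [sin tZ] maps [p] to [s q]; the commutator takes the value [- i s c e]. *)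
Lemma eigvecs_commutator t e : line e (Z e) ->
  line e (op_commutator P (orthproj (geodesic L Z t)) e).
Proof.
move=> eZ; have [c ce] := eigvecs_opcos Zb t eZ; have [s se] := eigvecs_opsin Zb t eZ.
rewrite /op_commutator !orthproj_geodesic.
set p := P e; pose q := e - p.
have cp : opcos t p = c *: p by rewrite -orthproj_opcos ce orthprojZ.
have sp : opsin t p = s *: q.
  rewrite /q scalerBr -se -orthprojZ // -se orthproj_opsin // -/p.
  by rewrite opsinB // subKr.
have PU : P (U t p) = c *: p.
  by rewrite orthproj_opexpi //; exact: (orthoprojP e cL).1.
have PUN : P (U (- t) p) = c *: p.
  by rewrite orthproj_opexpi ?opcosN //; exact: (orthoprojP e cL).1.
have UN : U (- t) e = (c - 'i%C * s) *: e.
  by rewrite opexpiNE ce se scalerBl scalerA.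
rewrite UN PUN orthprojZ // !opexpZ // orthprojZ // PU opexpiE // cp sp.
exists (- ('i%C * s * c)).
rewrite -[in RHS](subrK p e) -/q; move: (q) => y.
rewrite !scalerDr !scalerA opprD addrA -scalerBl [RHS]addrC.
by rewrite [in RHS](scaleNr _ y); congr (_ *: _ - _ *: _); ring.
Qed.

Lemma eq0_of_sub_split (S : set H) (c s : H) : closed_subspace S -> S c -> orthocompl S s ->
  S (c - 'i%C *: s) -> s = 0.
Proof.
move=> cS Sc os Ssum; apply: (orthocompl_disjoint _ os).
have -> : s = 'i%C *: ((c - 'i%C *: s) - c).
  by rewrite addrAC subrr add0r scalerN scaleii opprK.
by apply: subspaceZ => //; exact: subspaceB.
Qed.

Lemma eq0_of_compl_split (S : set H) (c s : H) : closed_subspace S -> S c -> orthocompl S s ->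
  orthocompl S (c - 'i%C *: s) -> c = 0.
Proof.
move=> cS Sc os Ssum; apply: (orthocompl_disjoint Sc).
have oS := orthocompl_subspace S.
by rewrite -[c](subrK ('i%C *: s)); apply: (subspaceD oS) => //; exact: (subspaceZ 'i%C oS).
Qed.

Let L1 := geodesic L Z 1.
Let Lcc := orthocomplK cL.

(** If [x] is in [L], then [exp(-iZ) x = cos(Z) x - i sin(Z) x] has its two
    terms in [L] and in its complement; so it is in [L] iff [sin(Z) x = 0], and in
    the complement iff [cos(Z) x = 0].  The same holds with the two subspaces
    exchanged. *)
Lemma nongeneric_pp (n : H) :
  set_sum (set_sum (L `&` L1) (Lc `&` orthocompl L1))
          (set_sum (L `&` orthocompl L1) (Lc `&` L1)) n -> pp_space Z n.
Proof.
have n1 : (1 : R) != 0 by exact: oner_neq0.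
have cp := pp_space_subspace Z.
rewrite /L1 orthocompl_geodesicE geodesicE /= => -[y1 [a [La /= Ma] [b [Lb /= Mb] <-]]].
move=> [y2 [c [Lc' /= Mc] [d [Ld /= Md] <-]] <-].
rewrite opexpiNE in Ma; rewrite opexpiNE in Mb.
rewrite opexpiNE in Mc; rewrite opexpiNE in Md.
apply: (subspaceD cp); apply: (subspaceD cp).
- apply: (opsin_ker_pp Zb Zs n1).
  by apply: (eq0_of_sub_split cL _ _ Ma); [exact: opcos_sub|exact: opsin_sub].
- apply: (opsin_ker_pp Zb Zs n1); apply: (eq0_of_sub_split cLc _ _ Mb).
    exact: opcos_compl.
  by rewrite Lcc; exact: opsin_compl.
- apply: (opcos_ker_pp Zb Zs n1).
  by apply: (eq0_of_compl_split cL _ _ Mc); [exact: opcos_sub|exact: opsin_sub].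
- apply: (opcos_ker_pp Zb Zs n1); apply: (eq0_of_compl_split (s := opsin 1 d) cLc).
  + exact: opcos_compl.
  + by rewrite Lcc; exact: opsin_compl.
  + by rewrite Lcc; exact: Md.
Qed.

(** [Z] commutes with [exp(iZ)], so it also exchanges [exp(iZ) L] and its
    complement; it therefore permutes the four pieces whose sum has the generic
    part as complement. *)
Lemma generic_part_invariant x : generic_part L L1 x -> generic_part L L1 (Z x).
Proof.
apply: orthocompl_invariant => // n.
have MM y : L1 y -> orthocompl L1 (Z y).
  rewrite /L1 orthocompl_geodesicE geodesicE /= -opexp_comm // => My.
  exact: codiagonal_sub.
have MC y : orthocompl L1 y -> L1 (Z y).
  rewrite /L1 orthocompl_geodesicE geodesicE /= -opexp_comm // => My.
  exact: codiagonal_compl.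
move=> [_ [a [La Ma] [b [Lb Mb] <-]] [_ [c [Lc' Mc] [d [Ld Md] <-]] <-]].
exists (Z b + Z a).
  exists (Z b); first by split; [exact: codiagonal_compl|exact: MC].
  by exists (Z a) => //; split; [exact: codiagonal_sub|exact: MM].
exists (Z d + Z c).
  exists (Z d); first by split; [exact: codiagonal_compl|exact: MM].
  by exists (Z c) => //; split; [exact: codiagonal_sub|exact: MC].
by rewrite !linearD /= [Z b + _]addrC [Z d + _]addrC.
Qed.

Lemma pp_generic : diagonalizable_on (generic_part L L1) Z -> pp_space Z = setT.
Proof.
move=> [B [oB BG] BZ].
have Gpp : generic_part L L1 `<=` pp_space Z.
  rewrite -BG; apply: closed_span_min; first exact: pp_space_subspace.
  by move=> b Bb; apply: sub_pp_space; have [_] := BZ Z b erefl Bb.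
apply: pp_space_total => x ox; apply: (orthocompl_disjoint _ ox).
by apply: Gpp => n /nongeneric_pp; exact: ox.
Qed.

Lemma generic_pp : pp_space Z = setT -> diagonalizable_on (generic_part L L1) Z.
Proof.
move=> ppT; have [B BG BZ] :=
  orthonormal_eigenbasis Zs ppT (orthocompl_subspace _) generic_part_invariant.
exists B => // T b -> Bb; split; last exact: BZ.
exact: orthonormal_neq0 BG.1 Bb.
Qed.

(** Let [x] be orthogonal to all eigenvectors of [Z].  The space they span is
    invariant under [Z] and under [P], so [P x] and then [Z x] are again orthogonal
    to it; inside [L] such a vector is killed by [cos tZ], hence spanned by
    eigenvectors, hence zero. *)
Lemma pp_of_Sd t : t != 0 -> Sd L (expi t Z) -> pp_space Z = setT.
Proof.
move=> t0 [_]; rewrite expi_opexp -complexiE => sd.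
have LC x : L x -> orthocompl (pp_space Z) x -> x = 0.
  move=> Lx ox; have cx : opcos t x = 0.
    apply: (schmidt_eigenvectors (C := lin_opcos Zb t) _ cL _ _ sd Lx) => /=.
    - exact: opcos_selfadjoint.
    - exact: opcos_sub.
    - by move=> h Lh; exact: orthproj_opexpi.
    - by move=> e _ /(opcos_eigvecs_pp Zb Zs t0); exact: ox.
  exact: orthocompl_disjoint (opcos_ker_pp Zb Zs t0 cx) ox.
have closed_inv (T : {linear H -> H}) : bounded_op T ->
    (forall e, line e (Z e) -> line (T e) (Z (T e))) ->
    forall x, pp_space Z x -> pp_space Z (T x).
  move=> Tb TZ; apply: closed_span_min.
    exact: preimage_subspace Tb (pp_space_subspace Z).
  by move=> e eZ; apply: sub_pp_space; exact: TZ.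
have Zpp : forall x, pp_space Z x -> pp_space Z (Z x).
  apply: closed_inv => // e [a Ze]; exists a.
  by rewrite -(linearZZ Z) -Ze.
have Jpp : forall x, pp_space Z x -> pp_space Z (J x).
  apply: closed_inv => [|e [a Ze]]; first exact: reflection_bounded.
  by exists (- a); rewrite -[LHS]opprK -reflection_anticomm Ze (linearZZ J) scaleNr.
have Ppp x : pp_space Z x -> pp_space Z (P x).
  move=> ppx; rewrite -(scale_halfD (P x)); apply: (subspaceZ _ (pp_space_subspace Z)).
  rewrite -[P x + P x](subrK x) -reflectionE.
  by apply: (subspaceD (pp_space_subspace Z)) => //; exact: Jpp.
apply: pp_space_total => x ox.
have Ps : selfadjoint P.
  move=> y z; have [Py oy] := orthoprojP y cL; have [Pz oz] := orthoprojP z cL.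
  rewrite -[in RHS](subrK (P y) y) -[in LHS](subrK (P z) z) innerDr innerDl.
  by rewrite (oy _ Pz) (inner_eq0C (oz _ Py)) !add0r.
have Px0 : P x = 0.
  apply: LC; first by case: (orthoprojP x cL).
  exact: orthocompl_invariant.
have Lcx : Lc x by have := (orthoprojP x cL).2; rewrite Px0 subr0.
have Zx0 : Z x = 0.
  apply: LC; first exact: codiagonal_compl.
  exact: orthocompl_invariant.
apply: (orthocompl_disjoint _ ox); apply: sub_pp_space.
by exists 0; rewrite Zx0 scale0r.
Qed.

(** Eigenvectors of [Z] are eigenvectors of [cos tZ], whose restriction to [L]
    thus has an eigenbasis, countable by separability. *)
Lemma Sd_of_pp t : separable_space H -> pp_space Z = setT -> Sd L (expi t Z).
Proof.
move=> sepH ppT; rewrite expi_opexp -complexiE; split; first exact: opexpi_unitary.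
have cs : selfadjoint (lin_opcos Zb t) by exact: opcos_selfadjoint.
have ppc : pp_space (lin_opcos Zb t) = setT.
  apply/seteqP; split=> // x _; have : pp_space Z x by rewrite ppT.
  apply: closed_span_min; first exact: pp_space_subspace.
  by move=> e eZ; apply: sub_pp_space; exact: eigvecs_opcos.
have [B BL BC] := orthonormal_eigenbasis cs ppc cL (@opcos_sub t).
apply: (schmidt_of_eigenbasis _ cs BL _ BC) => [||h Lh].
- exact: opcos_bounded.
- exact: orthonormal_countable sepH BL.1.
- exact: orthproj_opexpi.
Qed.

Lemma simultaneous_of_pp : pp_space Z = setT ->
  simultaneously_diagonalizable_on setT
     (range (fun t : R => expi t Z) `|`
      range (fun t : R => op_commutator P (orthproj (geodesic L Z t)))).
Proof.
move=> ppT.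
have cT : closed_subspace (setT : set H) by apply: closed_subspaceI.
have [B BT BZ] := orthonormal_eigenbasis Zs ppT cT (fun _ _ => I).
exists B => // _ b [[t _ <-]|[t _ <-]] Bb; (split; first exact: orthonormal_neq0 BT.1 Bb).
  by rewrite expi_opexp; exact: eigvecs_opexp (BZ _ Bb).
exact: eigvecs_commutator (BZ _ Bb).
Qed.

End Codiagonal.

Theorem theorem5p3 (R : realType) (H : hilbertType R) (L0 : set H)
    (Z : {linear H -> H}) :
  separable_space H ->
  closed_subspace L0 ->
  selfadjoint Z ->
  codiagonal L0 Z ->
  (opnorm Z <= (pi / 2)%:E)%E ->
  [<-> exists2 t0 : R, t0 != 0 & Sd L0 (expi t0 Z);
       forall t : R, Sd L0 (expi t Z);
       diagonalizable_on (generic_part L0 (geodesic L0 Z 1)) Z] /\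
  (diagonalizable_on (generic_part L0 (geodesic L0 Z 1)) Z ->
   simultaneously_diagonalizable_on setT
     (range (fun t : R => expi t Z) `|`
      range (fun t : R =>
        op_commutator (orthproj L0) (orthproj (geodesic L0 Z t))))).
Proof.
move=> sepH cL Zs Zcd /opnorm_bounded Zb; split; last first.
  by move=> /(pp_generic cL Zb Zs Zcd); exact: simultaneous_of_pp.
tfae.
- by move=> [t t0 /(pp_of_Sd cL Zb Zs Zcd t0) ppT] t'; exact: Sd_of_pp.
- by move=> /(_ 1) /(pp_of_Sd cL Zb Zs Zcd (oner_neq0 _)); exact: generic_pp.
- move=> /(pp_generic cL Zb Zs Zcd) ppT; exists 1; first exact: oner_neq0.
  exact: Sd_of_pp.
Qed.
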